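(* Suppose that $(\Omega, \mathcal{F}, \mathbb{P})$ is a discrete probability space with a biparameter filtration $(\mathcal{F}_{i,j} : i,j\in\mathbb{N})$ satisfying the $(F_4)$ condition. Then for each martingale $f=(f_{i,j}: i,j\in\mathbb{N})$ with respect to this filtration, $$\|f\|_{H^1_S} \simeq \inf_{f = g+h} \Big( \|g\|_{H^1_\sigma} + \sum_{i = 1}^\infty \sum_{j = 1}^\infty \mathbb{E} \big[|\Delta_{i,j}(h)|\big]\Big),$$ where the infimum is taken over all decompositions of $f$ as a sum of two martingales $g,h$ with respect to $(\mathcal{F}_{i,j})$. Here $\simeq$ means that each side is bounded by a constant multiple of the other, with positive finite constants independent of $f$.
   Context: $\mathbb{N}=\{1,2,\dots\}$. A probability space is discrete if $\Omega$ is at most countable. A double-indexed family of sub-$\sigma$-fields $(\mathcal{F}_{i,j})$ of $\mathcal{F}$ is a biparameter filtration if $\mathcal{F}_{i,j}\subset \mathcal{F}_{i,j+1}$ and $\mathcal{F}_{i,j}\subset\mathcal{F}_{i+1,j}$ for all indices. It satisfies the $(F_4)$ condition if for all $i,j,i',j'$ and all integrable $f$, $$\mathbb{E}\big(\mathbb{E}(f \mid \mathcal{F}_{i, j}) \mid \mathcal{F}_{i', j'}\big) = \mathbb{E}\big(f \mid \mathcal{F}_{\min\{i,i'\}, \min\{j,j'\}}\big).$$ A family of (real-valued) integrable random variables $f=(f_{i,j})$ is a martingale if $\mathbb{E}(f_{i',j'}\mid\mathcal{F}_{i,j})=f_{i,j}$ whenever $i'\ge i$, $j'\ge j$. Convention: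 $\mathcal{F}_{i,0}=\mathcal{F}_{0,j}=\{\emptyset,\Omega\}$. For $i,j\ge1$ let $\mathcal{F}^-_{i,j}=\mathcal{F}_{i-1,j}\vee\mathcal{F}_{i,j-1}$ be the $\sigma$-field generated by $\mathcal{F}_{i-1,j}$ and $\mathcal{F}_{i,j-1}$. The martingale differences are $$\Delta_{i, j}(f) = \begin{cases} f_{i, j} - f_{i-1, j} - f_{i, j -1} + f_{i-1, j-1} & \text{if } i \geq 2, j \geq 2, \\ f_{1, j} - f_{1, j-1} &\text{if } i = 1, j \geq 2, \\ f_{i, 1} - f_{i-1, 1} &\text{if } i \geq 2, j = 1, \\ f_{1, 1} & \text{if } i = j = 1. \end{cases}$$ The square functions are $$S(f) = \Big(\sum_{i = 1}^\infty \sum_{j = 1}^\infty |\Delta_{i, j} (f)|^2\Big)^{1/2},\qquad \sigma(f) = \Big(\sum_{i = 1}^\infty \sum_{j = 1}^\infty \mathbb{E}\big[ |\Delta_{i, j} (f)|^2 \,\big|\,\mathcal{F}^-_{i, j} \big]\Big)^{1/2},$$ and $\|f\|_{H^1_S}=\mathbb{E}[S(f)]$, $\|f\|_{H^1_\sigma}=\mathbb{E}[\sigma(f)]$ (values in $[0,\infty]$). *)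

(* Defs.v *)
(* Built on MathComp and MathComp-Analysis. *)
From HB Require Import structures.
From mathcomp Require Import all_boot all_order all_algebra.
From mathcomp Require Import all_classical all_reals all_analysis.
From mathcomp Require Import measurable_realfun.
Import Order.TTheory GRing.Theory Num.Theory.
Import numFieldNormedType.Exports.

Set Implicit Arguments.
Unset Strict Implicit.
Unset Printing Implicit Defensive.

Local Open Scope classical_set_scope.
Local Open Scope ring_scope.

Section conditional_expectation.
Context (R : realType) (d : measure_display) (T : measurableType d).
Variable P : probability T R.

(* The defining property, meant for a sub-sigma-field G (so that
   <<s G >> = G) and for X integrable or nonnegative measurable. *)
Definition is_cond_exp (G : set (set T)) (X Y : T -> \bar R) : Prop :=
  measurable_fun [set: g_sigma_algebraType G] Y /\
  (forall A, G A -> (\int[P]_(w in A) Y w = \int[P]_(w in A) X w)%E).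

(* A chosen version, everywhere nonnegative when X is. *)
Definition cond_exp (G : set (set T)) (X : T -> \bar R) : T -> \bar R :=
  xget (cst 0%E) [set Y | is_cond_exp G X Y /\
    ((forall w, (0 <= X w)%E) -> forall w, (0 <= Y w)%E)].

End conditional_expectation.

(* Indices range over {1, 2, ...}: in a family indexed by nat * nat, the
   entries with an index equal to 0 are never used. *)
Section biparameter.
Context (R : realType) (d : measure_display) (T : measurableType d).

Record biparameter_filtration (F : nat -> nat -> set (set T)) : Prop := {
  bf_sigma_algebra : forall i j, (1 <= i)%N -> (1 <= j)%N ->
    sigma_algebra [set: T] (F i j) ;
  bf_sub_measurable : forall i j, (1 <= i)%N -> (1 <= j)%N ->
    F i j `<=` measurable ;
  bf_mono_r : forall i j, (1 <= i)%N -> (1 <= j)%N -> F i j `<=` F i j.+1 ;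
  bf_mono_l : forall i j, (1 <= i)%N -> (1 <= j)%N -> F i j `<=` F i.+1 j
}.

Variable P : probability T R.

Definition F4_condition (F : nat -> nat -> set (set T)) : Prop :=
  forall i j i' j' : nat,
    (1 <= i)%N -> (1 <= j)%N -> (1 <= i')%N -> (1 <= j')%N ->
  forall X : T -> R, P.-integrable [set: T] (EFin \o X) ->
  {ae P, forall w,
    cond_exp P (F i' j') (cond_exp P (F i j) (EFin \o X)) w =
    cond_exp P (F (minn i i') (minn j j')) (EFin \o X) w}.

Definition martingale (F : nat -> nat -> set (set T))
    (f : nat -> nat -> T -> R) : Prop :=
  (forall i j, (1 <= i)%N -> (1 <= j)%N ->
    P.-integrable [set: T] (EFin \o f i j)) /\
  (forall i j i' j', (1 <= i)%N -> (1 <= j)%N -> (i <= i')%N -> (j <= j')%N ->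
    is_cond_exp P (F i j) (EFin \o f i' j') (EFin \o f i j)).

(* F with the convention that F i 0 and F 0 j are the trivial sigma-field. *)
Definition filtration0 (F : nat -> nat -> set (set T)) (i j : nat) :
    set (set T) :=
  if (i == 0)%N || (j == 0)%N then [set set0; [set: T]] else F i j.

Definition Fminus (F : nat -> nat -> set (set T)) (i j : nat) : set (set T) :=
  <<s filtration0 F i.-1 j `|` filtration0 F i j.-1 >>.

Definition mdiff (f : nat -> nat -> T -> R) (i j : nat) (w : T) : R :=
  match i, j with
  | i'.+2, j'.+2 =>
      f i'.+2 j'.+2 w - f i'.+1 j'.+2 w - f i'.+2 j'.+1 w + f i'.+1 j'.+1 w
  | 1%N, j'.+2 => f 1%N j'.+2 w - f 1%N j'.+1 w
  | i'.+2, 1%N => f i'.+2 1%N w - f i'.+1 1%N w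
  | 1%N, 1%N => f 1%N 1%N w
  | _, _ => 0
  end.

Definition square_function (f : nat -> nat -> T -> R) (w : T) : \bar R :=
  sqrte (\sum_(1 <= i <oo) \sum_(1 <= j <oo) (`|mdiff f i j w| ^+ 2)%:E)%E.

Definition cond_square_function (F : nat -> nat -> set (set T))
    (f : nat -> nat -> T -> R) (w : T) : \bar R :=
  sqrte (\sum_(1 <= i <oo) \sum_(1 <= j <oo)
    cond_exp P (Fminus F i j) (fun v => (`|mdiff f i j v| ^+ 2)%:E) w)%E.

Definition H1S_norm (f : nat -> nat -> T -> R) : \bar R :=
  (\int[P]_w square_function f w)%E.

Definition H1sigma_norm (F : nat -> nat -> set (set T))
    (f : nat -> nat -> T -> R) : \bar R :=
  (\int[P]_w cond_square_function F f w)%E.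

Definition sum_mdiff_norm (f : nat -> nat -> T -> R) : \bar R :=
  (\sum_(1 <= i <oo) \sum_(1 <= j <oo) 'E_P[fun w => `|mdiff f i j w|%R])%E.

Definition inf_decomposition (F : nat -> nat -> set (set T))
    (f : nat -> nat -> T -> R) : \bar R :=
  ereal_inf [set x : \bar R | exists g h : nat -> nat -> T -> R,
    [/\ martingale F g,
        martingale F h,
        (forall i j w, (1 <= i)%N -> (1 <= j)%N ->
           f i j w = g i j w + h i j w) &
        x = (H1sigma_norm F g + sum_mdiff_norm h)%E]].

End biparameter.

(* Main.v *)
(* On a countable space every sigma-field is given by its partition into atoms,
   and conditional expectations are averages over atoms.

   (F4) makes F_{i,j} independent of F_{i-1,N} \/ F_{i,j-1} conditionally on
   F^-_{i,j} = F_{i-1,j} \/ F_{i,j-1}. Hence conditional expectations given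
   F^-_{i,j} of F_{i,j}-measurable functions do not change when F^-_{i,j} is
   replaced by the whole past of (i,j) in the lexicographic order of the N x N
   grid, and one-parameter arguments apply: if D_n is predictable, nondecreasing
   and dominates the partial sums of a_n >= 0, then E sqrt(sum E[a_n | past]) and
   E sqrt(sum a_n) are compared by integrating against D_n^{-1/2}. This gives
   E S(g) <= (3/2) E sigma(g).

   For the converse put s = S(f), X = Delta_{i,j} f and
   lambda_{i,j} = 4 E[sqrt s | F^-_{i,j}]^2, and cut X = U + V with V the part
   where |X| > lambda. By Markov and conditional independence, E|V| at most
   doubles when V is restricted to {S_past <= lambda}, where S_past is the
   lexicographic partial square function; there |V| <= 3 (S_next - S_past), so
   sum E|V| <= 6 E s. Three uses of Doob's inequality in L^2 give
   E sup lambda <= 256 E s, so the predictable bound |U| <= lambda controls the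
   conditional square function of U. Finally h is the martingale with
   differences V - C, where C = E[V | F_{i-1,j}] + E[V | F_{i,j-1}] -
   E[V | F_{i-1,j-1}], and g = f - h has differences U + C with C measurable for
   F^-_{i,j} and sum E|C| <= 3 sum E|V|. *)
Require Import Defs.
From mathcomp Require Import all_boot all_order all_algebra.
From mathcomp Require Import all_classical all_reals all_analysis.
From mathcomp Require Import measurable_realfun ring lra zify.
Import Order.TTheory GRing.Theory Num.Theory.
Import numFieldNormedType.Exports.
Set Implicit Arguments.
Unset Strict Implicit.
Unset Printing Implicit Defensive.
Local Open Scope classical_set_scope.
Local Open Scope ring_scope.

(** * Partitions into atoms *)

(** The sigma-fields F^-_{i,j} do not in general increase along the lexicographic order, so
    one-parameter results do not apply to them directly; they are proved for the lexicographic past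
    and then carried over. That past is in turn too large to define the cut: with a threshold read
    off it, such as a running maximum of earlier differences, U and V would not be
    F_{i,j}-measurable in general, and h would not be a martingale for the two-parameter filtration.
    Hence the threshold is measurable for F^-_{i,j}, and the past square function enters only under
    expectations. The threshold is built from sqrt s rather than s because the maximal function of a
    merely integrable function need not be integrable, whereas sqrt s is square integrable as soon
    as s is integrable. Its factor 4 is the square of the 2 in Markov's inequality. Constants: 3 = 2
    * 3/2 in one direction. In the other, 831 = 807 + 24, where 24 = (1 + 3) * 6 bounds the part h,
    and 807 = 2 * (3/2 * 257 + 18) bounds g, with 18 = 3 * 6, 257 = 1 + 256 and 256 = 4 * 4^3. *)

Section partitions.
Context (T : Type).
Implicit Types (r : T -> set T) (G : set (set T)).

(** Partitions are carried as maps sending a point to its class. [G] may be any family of sets, in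
    particular a generating one: points share a class when no member of [G] separates them. *)
Definition atom G (w : T) : set T := [set v | forall A, G A -> (A w <-> A v)].

Definition is_partition r :=
  (forall w, r w w) /\ (forall w v, r w v -> r v = r w).

(** Constancy on classes, the form that measurability takes on a countable space. *)
Definition adapted r (U : Type) (X : T -> U) := forall w v, r w v -> X v = X w.

Lemma atom_partition G : is_partition (atom G).
Proof.
split=> [w A //|w v wv]; apply/seteqP; split => u vu A GA.
  by rewrite (wv A GA); exact: vu.
by rewrite -(wv A GA); exact: vu.
Qed.

(** The sets that do not separate two given points form a sigma-field, so a generating family
    separates as much as the sigma-field it generates. *)
Lemma atom_generated G : atom <<s G >> = atom G.
Proof.
apply/funext => w; apply/seteqP; split => v wv A GA.
  by apply: wv; exact: sub_gen_smallest.
pose H := [set B : set T | B w <-> B v].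
suff : <<s G >> `<=` H by exact.
apply: smallest_sub => //; split => [|B|] //=.
- by rewrite /H /= => -[h1 h2]; split => -[_ nB]; split => // /[dup] hB ?; apply: nB; auto.
by move=> F HF; split => -[n _ Fn]; exists n => //; apply/(HF n).
Qed.

Lemma atomU G H w : atom (G `|` H) w = atom G w `&` atom H w.
Proof.
apply/seteqP; split => v.
  by move=> h; split => A GA; apply: h; [left|right].
by case=> h1 h2 A [GA|HA]; [exact: h1|exact: h2].
Qed.

Lemma atomS G H w : G `<=` H -> atom H w `<=` atom G w.
Proof. by move=> GH v h A /GH; exact: h. Qed.

Lemma atom_trivial w : atom [set set0; setT] w = setT.
Proof. by apply/seteqP; split => // v _ A /= [->|->]. Qed.

Lemma is_partitionI r1 r2 :
  is_partition r1 -> is_partition r2 -> is_partition (fun w => r1 w `&` r2 w).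
Proof.
move=> [r11 h1] [r22 h2]; split => [w|w v [a b]]; first by split.
by rewrite (h1 _ _ a) (h2 _ _ b).
Qed.

Lemma partition_sym r : is_partition r -> forall w v, r w v -> r v w.
Proof. by move=> [h1 h2] w v /h2 ->. Qed.

Lemma adapted_class r : is_partition r -> adapted r r.
Proof. by case. Qed.

Lemma adaptedS r1 r2 U (X : T -> U) : (forall w, r1 w `<=` r2 w) ->
  adapted r2 X -> adapted r1 X.
Proof. by move=> h a w v /h/a. Qed.

Lemma adapted_comp r U V (X : T -> U) (g : U -> V) :
  adapted r X -> adapted r (fun w => g (X w)).
Proof. by move=> a w v /a ->. Qed.

Lemma adapted_comp2 r U V W (X : T -> U) (Y : T -> V) (g : U -> V -> W) :
  adapted r X -> adapted r Y -> adapted r (fun w => g (X w) (Y w)).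
Proof. by move=> a b w v rwv; rewrite (a _ _ rwv) (b _ _ rwv). Qed.

Lemma adapted_cst r U (x : U) : adapted r (fun=> x).
Proof. by []. Qed.

End partitions.

Lemma adapted_sum T (r : T -> set T) (V : nmodType) I (s : seq I) (Q : pred I)
    (X : I -> T -> V) : (forall i, Q i -> adapted r (X i)) ->
  adapted r (fun w => \sum_(i <- s | Q i) X i w).
Proof. by move=> h w v rwv; apply: eq_bigr => i Qi; exact: h. Qed.

(** * Measurability on a countable space *)

Section countable_measurable_space.
Context d (T : measurableType d).
Hypothesis cT : countable [set: T].

(** Singletons need not be measurable; the atoms of the full sigma-field are the finest classes
    available and stand in for points. *)
Definition point_atom : T -> set T := atom (@measurable _ T).

(** Each of the countably many points outside the atom is separated from [w] by some measurable set;
    the atom is the intersection of the sets chosen. *)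
Lemma measurable_point_atom w : measurable (point_atom w).
Proof.
pose sep v := [set B : set T | measurable B /\ B w /\ ~ B v].
have sepP v : ~ point_atom w v -> sep v (xget setT (sep v)).
  move=> nwv; apply: xgetPex; apply: contrapT => nex; apply: nwv => A mA.
  split => [Aw|Av]; apply: contrapT => nA.
    by apply: nex; exists A.
  by apply: nex; exists (~` A); split; [exact: measurableC|split => //; exact].
pose N v := if pselect (point_atom w v) then set0 else ~` xget setT (sep v).
suff -> : point_atom w = ~` \bigcup_v N v.
  apply: measurableC; apply: countable_bigcupT_measurable => // v.
  rewrite /N; case: pselect => [?|nwv]; first exact: measurable0.
  by have [/measurableC] := sepP _ nwv.
apply/seteqP; split => v.
  move=> wv [u _]; rewrite /N; case: pselect => // nwu.
  by have [mB [Bw _]] := sepP _ nwu; apply; apply/(wv _ mB).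
move=> nN; apply: contrapT => nwv; apply: nN; exists v => //.
by rewrite /N; case: pselect => // nwv'; have [_ []] := sepP _ nwv'.
Qed.

Lemma measurable_saturated (A : set T) :
  (forall w v, A w -> point_atom w v -> A v) -> measurable A.
Proof.
move=> satA.
rewrite (_ : A = \bigcup_v (if pselect (A v) then point_atom v else set0)).
  apply: countable_bigcupT_measurable => // v.
  by case: pselect => ?; last exact: measurable0; exact: measurable_point_atom.
apply/seteqP; split => v.
  by move=> Av; exists v => //; case: pselect.
by move=> [u _]; case: pselect => // Au; exact: satA.
Qed.

Lemma measurable_fun_adapted d' (U : measurableType d') (X : T -> U) :
  adapted point_atom X -> measurable_fun setT X.
Proof.
move=> aX _ B mB; rewrite setTI; apply: measurable_saturated => w v /= Xw wv.
by rewrite (aX _ _ wv).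
Qed.

Lemma sub_point_atom (A : set T) w : measurable A -> A w -> point_atom w `<=` A.
Proof. by move=> mA Aw v /(_ A mA) <-. Qed.

End countable_measurable_space.
Arguments point_atom {d T}.

Section sub_sigma_fields.
Context d (T : measurableType d) (G : set (set T)).
Hypothesis cT : countable [set: T].

(** Viewing [<<s G >>] as the sigma-field of [g_sigma_algebraType G] makes the results on point
    atoms available for the atoms of [G]. *)
Lemma point_atom_generated :
  @point_atom _ (g_sigma_algebraType G) = atom G.
Proof. exact: atom_generated. Qed.

Lemma atom_measurable w : <<s G >> (atom G w).
Proof.
rewrite -point_atom_generated.
exact: (@measurable_point_atom _ (g_sigma_algebraType G)).
Qed.

Lemma measurable_fun_atom d' (U : measurableType d') (X : T -> U) :
  adapted (atom G) X -> measurable_fun [set: g_sigma_algebraType G] X.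
Proof.
move=> aX; apply: measurable_fun_adapted => //.
by rewrite point_atom_generated.
Qed.

Lemma adapted_atom (R : realType) (X : T -> \bar R) :
  measurable_fun [set: g_sigma_algebraType G] X -> adapted (atom G) X.
Proof.
move=> mX; rewrite -point_atom_generated => w v wv.
have := mX measurableT [set X w] (emeasurable_set1 _).
rewrite setTI => mXw; have [h _] := wv _ mXw; exact: h.
Qed.

End sub_sigma_fields.

(** * Integrals class by class, and points of positive mass *)

Section integrals_over_classes.
Context (R : realType) d (T : measurableType d) (P : probability T R).
Hypothesis cT : countable [set: T].

Definition measurable_partition (r : T -> set T) :=
  is_partition r /\ forall w, measurable (r w).

Lemma point_atom_partition : measurable_partition (@point_atom _ T).
Proof.
by split=> [|w]; [exact: atom_partition|exact: measurable_point_atom].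
Qed.

Lemma measurable_partitionI r1 r2 : measurable_partition r1 ->
  measurable_partition r2 -> measurable_partition (fun w => r1 w `&` r2 w).
Proof.
move=> [p1 m1] [p2 m2]; split; first exact: is_partitionI.
by move=> w; exact: measurableI.
Qed.

Lemma class_measure_fin (A : set T) : measurable A -> P A \is a fin_num.
Proof. by move=> mA; exact: fin_num_measure. Qed.

Lemma sub_point_atom_class r w : measurable_partition r -> point_atom w `<=` r w.
Proof. by move=> [[r1 _] m]; exact: sub_point_atom. Qed.

Lemma adapted_point_atom r U (X : T -> U) : measurable_partition r ->
  adapted r X -> adapted point_atom X.
Proof. by move=> pr; apply: adaptedS => w; exact: sub_point_atom_class. Qed.

Definition saturated (r : T -> set T) (A : set T) :=
  forall w, A w -> r w `<=` A.

(** With the points numbered by an injection [f], a class is listed at the smallest number of its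
    elements; all other indices carry the empty set. This enumerates the classes without repetition,
    ready for countable additivity. *)
Lemma saturated_classes r (A : set T) :
  measurable_partition r -> saturated r A ->
  exists B : nat -> set T, [/\ forall k, measurable (B k), trivIset setT B,
    \bigcup_k B k = A & forall k, B k = set0 \/ exists2 w, A w & B k = r w].
Proof.
move=> [[r1 r2] mr] satA; have [f finj] := countable_injP _ cT.
have injf w v : f w = f v -> w = v by apply: finj; rewrite in_setT.
pose first k w := [/\ A w, f w = k & forall v, r w v -> (f w <= f v)%N].
pose B k := \bigcup_(w in first k) r w.
have BE k w : first k w -> B k = r w.
  move=> fw; apply/seteqP; split => v; last by move=> ?; exists w.
  move=> [u [_ fu _]]; case: fw => _ fw _.
  by rewrite (injf u w) // fw.
have B0 k : B k = set0 \/ exists2 w, A w & B k = r w.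
  have [[w fw]|nw] := pselect (exists w, first k w).
    by right; exists w; [case: fw|exact: BE].
  left; apply/seteqP; split => // v [w fw _]; case: nw; by exists w.
exists B; split => //.
- by move=> k; case: (B0 k) => [->|[w _ ->]].
- move=> i j _ _ [v [[u [Au fu mu] uv] [w [Aw fw mw] wv]]].
  have E : r u = r w by rewrite -(r2 _ _ uv) -(r2 _ _ wv).
  rewrite -fu -fw; apply/eqP; rewrite eqn_leq; apply/andP; split.
    by apply: mu; rewrite E.
  by apply: mw; rewrite -E.
- apply/seteqP; split => [v [k _ [w [Aw _ _]]]|v Av]; first exact: satA.
  have [k] : exists k, `[< exists2 w, r v w & f w = k >].
    by exists (f v); apply/asboolP; exists v.
  move=> /[dup] /asboolP ex0 ex0'.
  have ex : exists k, `[< exists2 w, r v w & f w = k >] by exists k.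
  case: (ex_minnP ex) => m /asboolP[w vw fw] mmin.
  exists m => //; exists w.
    split => //; first exact: satA vw.
    move=> u wu; rewrite fw; apply: mmin; apply/asboolP; exists u => //.
    by rewrite -(r2 _ _ vw).
  by rewrite (r2 _ _ vw).
Qed.

Local Open Scope ereal_scope.

Lemma ge0_eq_integral_classes r (A : set T) (X1 X2 : T -> \bar R) :
  measurable_partition r -> saturated r A ->
  adapted point_atom X1 -> adapted point_atom X2 ->
  (forall w, 0 <= X1 w) -> (forall w, 0 <= X2 w) ->
  (forall w, A w -> \int[P]_(v in r w) X1 v = \int[P]_(v in r w) X2 v) ->
  \int[P]_(w in A) X1 w = \int[P]_(w in A) X2 w.
Proof.
move=> pr satA a1 a2 p1 p2 e.
have [B [mB tB BA B0]] := saturated_classes pr satA.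
rewrite -BA ge0_integral_bigcup// ?[RHS]ge0_integral_bigcup//.
- apply: eq_eseriesr => k _; case: (B0 k) => [->|[w Aw ->]].
    by rewrite !integral_set0.
  exact: e.
- exact/measurable_funTS/measurable_fun_adapted.
- exact/measurable_funTS/measurable_fun_adapted.
Qed.

Lemma eq_integral_classes r (A : set T) (X1 X2 : T -> \bar R) :
  measurable_partition r -> saturated r A ->
  P.-integrable A X1 -> P.-integrable A X2 ->
  (forall w, A w -> \int[P]_(v in r w) X1 v = \int[P]_(v in r w) X2 v) ->
  \int[P]_(w in A) X1 w = \int[P]_(w in A) X2 w.
Proof.
move=> pr satA i1 i2 e.
have [B [mB tB BA B0]] := saturated_classes pr satA.
move: i1 i2; rewrite -BA => i1 i2.
rewrite integral_bigcup// [RHS]integral_bigcup//.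
apply: eq_eseriesr => k _; case: (B0 k) => [->|[w Aw ->]].
  by rewrite !integral_set0.
exact: e.
Qed.

(** Points whose atom has mass. The remaining ones form a null set, so an almost sure statement is a
    pointwise one at [pos] points, and there no class average is divided by 0. *)
Definition pos (w : T) := P (point_atom w) != 0.

Lemma adapted_pos : adapted point_atom pos.
Proof. by move=> w v wv; rewrite /pos /point_atom (adapted_class (atom_partition _) wv). Qed.

(** The functions 1 and 0 have the same integral over each null atom, and these countably many atoms
    make up the set. *)
Lemma null_nonpos : P [set w | ~~ pos w] = 0.
Proof.
have h : saturated point_atom [set w | ~~ pos w].
  by move=> w /= nw v wv /=; rewrite (adapted_pos wv).
have mh : measurable [set w | ~~ pos w].
  by apply: measurable_saturated => // w v /h; exact.
rewrite -[LHS]mul1e -integral_cst//.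
rewrite (@ge0_eq_integral_classes point_atom _ _ (cst 0))//.
- by rewrite integral0.
- exact: point_atom_partition.
- move=> w /= /negPn /eqP Pw.
  rewrite !integral_cst//; try exact: measurable_point_atom.
  by rewrite mul0e mul1e.
Qed.

Lemma measurable_nonpos : measurable [set w | ~~ pos w].
Proof.
apply: measurable_saturated => // w v /= + wv.
by rewrite (adapted_pos wv).
Qed.

Lemma ae_pos (Q : T -> Prop) :
  (forall w, pos w -> Q w) -> {ae P, forall w, Q w}.
Proof.
move=> h; exists [set w | ~~ pos w]; split.
- exact: measurable_nonpos.
- exact: null_nonpos.
- by move=> w /= nQ; apply/negP => /h.
Qed.

(** A null set containing [w] contains the whole atom of [w], which has positive mass when [pos w]
    holds. *)
Lemma pos_ae (Q : T -> Prop) :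
  {ae P, forall w, Q w} -> forall w, pos w -> Q w.
Proof.
move=> [N [mN PN0 sN]] w /eqP pw; apply: contrapT => nQ; apply: pw.
apply: (subset_measure0 _ mN _ PN0); first exact: measurable_point_atom.
by apply: sub_point_atom => //; exact: sN.
Qed.

Lemma pos_class r w : measurable_partition r -> pos w ->
  (0 < fine (P (r w)))%R.
Proof.
move=> pr /eqP pw; rewrite fine_gt0// ltey_eq class_measure_fin ?andbT; last first.
  by case: pr.
rewrite lt0e measure_ge0 andbT; apply/eqP => h; apply: pw.
apply: (subset_measure0 _ _ _ h); [exact: measurable_point_atom|by case: pr|].
exact: sub_point_atom_class.
Qed.

(** Functions constant on classes have to be compared at one positive point of each non-null class
    only; this supplies the point. *)
Lemma class_pos r w : measurable_partition r -> P (r w) != 0 ->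
  exists2 v, r w v & pos v.
Proof.
move=> pr /eqP pw; apply: contrapT => h; apply: pw.
apply: (subset_measure0 _ _ _ null_nonpos); [by case: pr|exact: measurable_nonpos|].
by move=> v wv /=; apply/negP => pv; apply: h; exists v.
Qed.

Lemma eq_integral_pos (A : set T) (X1 X2 : T -> \bar R) : measurable A ->
  adapted point_atom X1 -> adapted point_atom X2 ->
  (forall w, pos w -> X1 w = X2 w) ->
  \int[P]_(w in A) X1 w = \int[P]_(w in A) X2 w.
Proof.
move=> mA a1 a2 e; apply: ae_eq_integral => //.
- exact/measurable_funTS/measurable_fun_adapted.
- exact/measurable_funTS/measurable_fun_adapted.
- by apply: ae_pos => w /e ->.
Qed.

Lemma le_integral_pos (A : set T) (X1 X2 : T -> \bar R) : measurable A ->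
  adapted point_atom X1 -> adapted point_atom X2 ->
  (forall w, 0 <= X1 w) -> (forall w, 0 <= X2 w) ->
  (forall w, pos w -> X1 w <= X2 w) ->
  \int[P]_(w in A) X1 w <= \int[P]_(w in A) X2 w.
Proof.
move=> mA a1 a2 p1 p2 e; apply: ae_ge0_le_integral => //.
- exact/measurable_funTS/measurable_fun_adapted.
- exact/measurable_funTS/measurable_fun_adapted.
- by apply: ae_pos => w /e.
Qed.

Lemma eq_integrable_pos (A : set T) (X1 X2 : T -> \bar R) : measurable A ->
  adapted point_atom X1 -> adapted point_atom X2 ->
  (forall w, pos w -> X1 w = X2 w) ->
  P.-integrable A X1 -> P.-integrable A X2.
Proof.
move=> mA a1 a2 e /integrableP[_ i1]; apply/integrableP; split.
  exact/measurable_funTS/measurable_fun_adapted.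
apply: le_lt_trans i1; rewrite le_eqVlt; apply/orP; left; apply/eqP.
apply: eq_integral_pos => //; try exact: adapted_comp.
by move=> w /e ->.
Qed.

Lemma le_integrable_pos (A : set T) (X1 X2 : T -> R) : measurable A ->
  adapted point_atom X1 -> adapted point_atom X2 ->
  (forall w, pos w -> `|X1 w| <= `|X2 w|)%R ->
  P.-integrable A (EFin \o X2) -> P.-integrable A (EFin \o X1).
Proof.
move=> mA a1 a2 e /integrableP[_ i1]; apply/integrableP; split.
  apply/measurable_funTS/measurable_fun_adapted => //; exact: adapted_comp.
apply: le_lt_trans i1; apply: le_integral_pos => //.
- exact: (adapted_comp (fun x : R => `|x%:E|)).
- exact: (adapted_comp (fun x : R => `|x%:E|)).
Qed.

End integrals_over_classes.

(** * Conditional expectation given a partition *)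

Section conditional_expectation_on_classes.
Context (R : realType) d (T : measurableType d) (P : probability T R).
Hypothesis cT : countable [set: T].
Implicit Types (r : T -> set T) (X Y : T -> R).

(* The average of X over the class of w; null classes get the junk value 0. *)
Definition rce r X (w : T) : R := (\int[P]_(v in r w) X v) / fine (P (r w)).

(* Integrability over each class; [lint (fun=> setT)] is integrability. *)
Definition lint r X :=
  adapted point_atom X /\ forall w, P.-integrable (r w) (EFin \o X).

Lemma rce_adapted r X : is_partition r -> adapted r (rce r X).
Proof. by move=> [_ h] w v /h; rewrite /rce => ->. Qed.

Section fixed_partition.
Variable r : T -> set T.
Hypothesis pr : measurable_partition r.

Let mr w : measurable (r w). Proof. by case: pr. Qed.

Lemma lintD X Y : lint r X -> lint r Y -> lint r (fun w => X w + Y w).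
Proof.
move=> [aX iX] [aY iY]; split; first exact: adapted_comp2.
by move=> w; exact: (integrableD (mr w) (iX w) (iY w)).
Qed.

Lemma lintB X Y : lint r X -> lint r Y -> lint r (fun w => X w - Y w).
Proof.
move=> [aX iX] [aY iY]; split; first exact: (adapted_comp2 (fun x y => x - y)).
by move=> w; exact: (integrableB (mr w) (iX w) (iY w)).
Qed.

Lemma lint_le X Y : adapted point_atom X ->
  (forall w, pos P w -> `|X w| <= `|Y w|) -> lint r Y -> lint r X.
Proof.
by move=> aX h [aY iY]; split => // w; exact: (le_integrable_pos cT _ aX aY).
Qed.

Lemma lint_norm X : lint r X -> lint r (fun w => `|X w|).
Proof.
move=> lX; apply: lint_le (lX); last by move=> w _; rewrite normr_id.
by apply: (adapted_comp (fun x => `|x|)); case: lX.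
Qed.

Lemma lint_cst (c : R) : lint r (fun=> c).
Proof.
by split => // w; exact: finite_measure_integrable_cst.
Qed.

Lemma lintZ X Y : adapted r Y -> lint r X -> lint r (fun w => Y w * X w).
Proof.
move=> aY [aX iX]; have aY' := adapted_point_atom pr aY.
split=> [|w]; first exact: (adapted_comp2 (fun x y => x * y)).
apply: eq_integrable (integrableZl (mr w) (Y w) (iX w)) => //.
by move=> v; rewrite inE => wv; rewrite /= (aY _ _ wv).
Qed.

Lemma lint_adapted X : adapted r X -> lint r X.
Proof.
move=> aX; have := lintZ aX (lint_cst 1).
by rewrite (_ : (fun w => X w * 1) = X)//; apply/funext => w; rewrite mulr1.
Qed.

Lemma lint_sum I (s : seq I) (X : I -> T -> R) :
  (forall i, lint r (X i)) -> lint r (fun w => \sum_(i <- s) X i w).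
Proof.
move=> h; elim: s => [|i s ih].
  by under eq_fun do rewrite big_nil; exact: lint_cst.
by under eq_fun do rewrite big_cons; exact: lintD.
Qed.

Lemma rceD X Y w : lint r X -> lint r Y ->
  rce r (fun v => X v + Y v) w = rce r X w + rce r Y w.
Proof. by move=> [_ iX] [_ iY]; rewrite /rce RintegralD// mulrDl. Qed.

Lemma rceB X Y w : lint r X -> lint r Y ->
  rce r (fun v => X v - Y v) w = rce r X w - rce r Y w.
Proof. by move=> [_ iX] [_ iY]; rewrite /rce RintegralB// mulrBl. Qed.

Lemma rceM X Y w : adapted r Y -> lint r X ->
  rce r (fun v => Y v * X v) w = Y w * rce r X w.
Proof.
move=> aY [_ iX]; rewrite /rce mulrA -RintegralZl//; congr (_ / _).
by apply: eq_Rintegral => v; rewrite inE => wv; rewrite (aY _ _ wv).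
Qed.

Lemma rce_cst (c : R) w : pos P w -> rce r (fun=> c) w = c.
Proof.
move=> pw; rewrite /rce Rintegral_cst// mulfK// gt_eqF//.
exact: pos_class.
Qed.

Lemma rce_id X w : adapted r X -> pos P w -> rce r X w = X w.
Proof.
move=> aX pw; have := rceM w aX (lint_cst 1).
rewrite rce_cst// mulr1 => <-; congr rce; apply/funext => v.
by rewrite mulr1.
Qed.

Lemma eq_rce X Y w : adapted point_atom X -> adapted point_atom Y ->
  (forall v, pos P v -> r w v -> X v = Y v) -> rce r X w = rce r Y w.
Proof.
move=> aX aY e; rewrite /rce /Rintegral; congr (fine _ / _).
apply: ae_eq_integral => //.
- by apply/measurable_funTS/measurable_fun_adapted => //; exact: adapted_comp.
- by apply/measurable_funTS/measurable_fun_adapted => //; exact: adapted_comp.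
- by apply: (ae_pos cT) => v pv wv; rewrite /= e.
Qed.

Lemma rce_ge0 X w : (forall v, 0 <= X v) -> 0 <= rce r X w.
Proof.
move=> X0; apply: divr_ge0; last exact: fine_ge0.
by apply: Rintegral_ge0.
Qed.

Lemma le_rce X Y w : lint r X -> lint r Y ->
  (forall v, pos P v -> r w v -> X v <= Y v) -> rce r X w <= rce r Y w.
Proof.
move=> lX lY h; rewrite -subr_ge0 -rceB//.
(* [rce_ge0] asks for nonnegativity everywhere, while [X <= Y] is known only at positive points of
   the class of [w]; the absolute value bridges the gap. *)
rewrite (@eq_rce _ (fun v => `|Y v - X v|)).
- by apply: rce_ge0.
- by have [] := lintB lY lX.
- by have [] := lint_norm (lintB lY lX).
- by move=> v pv wv; rewrite ger0_norm// subr_ge0 h.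
Qed.

Lemma norm_rce X w : lint r X -> `|rce r X w| <= rce r (fun v => `|X v|) w.
Proof.
move=> lX; rewrite /rce normrM normfV (@ger0_norm _ (fine (P _))) ?fine_ge0//.
by apply: ler_wpM2r; [rewrite invr_ge0 fine_ge0|apply: le_normr_Rintegral; case: lX].
Qed.

(** On a class of mass 0 both sides vanish; elsewhere the division in [rce] is undone. *)
Lemma integral_class X w : lint r X ->
  (\int[P]_(v in r w) (X v)%:E)%E = (rce r X w * fine (P (r w)))%:E.
Proof.
move=> [aX iX]; rewrite /rce /Rintegral.
have [P0|Pn0] := eqVneq (fine (P (r w))) 0.
  rewrite P0 mulr0; apply: null_set_integral => //.
    by have /integrableP[] := iX w.
  by move/eqP: P0; rewrite fine_eq0 ?class_measure_fin// => /eqP.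
by rewrite divfK// fineK// integrable_fin_num.
Qed.

(** Jensen's inequality for the square, obtained by averaging [(X - c)^2 >= 0] with [c] the average
    of [X]. *)
Lemma rce_sqr X w : pos P w -> lint r X -> lint r (fun v => X v ^+ 2) ->
  rce r X w ^+ 2 <= rce r (fun v => X v ^+ 2) w.
Proof.
move=> pw lX lX2; set c := rce r X w.
have l1 : lint r (fun v => (2 * c) * X v) by exact: lintZ.
have : 0 <= rce r (fun v => X v ^+ 2 - ((2 * c) * X v - c ^+ 2)) w.
  apply: rce_ge0 => v; rewrite (_ : _ - _ = (X v - c) ^+ 2) ?sqr_ge0//; ring.
have lc := lint_cst (c ^+ 2).
rewrite rceB//; last exact: lintB.
rewrite rceB// (@rceM X (fun=> 2 * c))// rce_cst// -/c.
lra.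
Qed.

(** The identity is summed over classes. Nonnegativity allows both sides to be infinite, so [X] is
    integrable on each class without being integrable. *)
Lemma ge0_integral_rce X Y : (forall w, 0 <= X w) -> (forall w, 0 <= Y w) ->
  lint r X -> adapted r Y ->
  (\int[P]_w (rce r X w * Y w)%:E = \int[P]_w (X w * Y w)%:E)%E.
Proof.
move=> X0 Y0 lX aY; have aY' := adapted_point_atom pr aY.
have [pr1 _] := pr.
have arce := adapted_point_atom pr (rce_adapted X pr1).
apply: (ge0_eq_integral_classes cT pr) => //.
- exact: (adapted_comp2 (fun x y => (x * y)%:E)).
- apply: (adapted_comp2 (fun x y => (x * y)%:E)) => //; by case: lX.
- by move=> w; rewrite lee_fin mulr_ge0// rce_ge0.
- by move=> w; rewrite lee_fin mulr_ge0.
move=> w _.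
have -> : (\int[P]_(v in r w) (X v * Y v)%:E =
           \int[P]_(v in r w) (Y v * X v)%:E)%E.
  by apply: eq_integral => v _; rewrite mulrC.
rewrite (@integral_class (fun v => Y v * X v)); last exact: lintZ.
rewrite (@integral_class (fun v => rce r X v * Y v)); last first.
  apply: lint_adapted; apply: (adapted_comp2 (fun x y => x * y)) => //.
  exact: rce_adapted.
rewrite (@rceM X Y)// (@rceM Y (rce r X))//;
  [|exact: rce_adapted|exact: lint_adapted].
have [pw|/negPn/eqP pw] := boolP (P (r w) != 0%E); last by rewrite pw/= !mulr0.
have [v wv pv] := class_pos cT pr pw.
have aa := rce_adapted _ pr1.
rewrite -(aa Y _ _ wv) (@rce_id Y)// (aY _ _ wv); congr (_ * _)%:E; ring.
Qed.

End fixed_partition.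

Lemma lintS r1 r2 X : measurable_partition r1 -> measurable_partition r2 ->
  (forall w, r1 w `<=` r2 w) -> lint r2 X -> lint r1 X.
Proof.
move=> [_ m1] [_ m2] h [aX iX]; split => // w.
exact: integrableS (iX w).
Qed.

Section nested_partitions.
Variables r r0 : T -> set T.
Hypotheses (pr : measurable_partition r) (pr0 : measurable_partition r0).
Hypothesis sub : forall w, r w `<=` r0 w.

Lemma saturated_sub w : saturated r (r0 w).
Proof.
move=> v wv; have [[_ h] _] := pr0.
by rewrite -(h _ _ wv); exact: sub.
Qed.

(** [|rce r X|] is at most [rce r |X|], whose integral over a class of the coarser [r0] is computed
    class by class of [r] and equals that of [|X|]. *)
Lemma lint_rce X : lint r0 X -> lint r0 (rce r X).
Proof.
move=> lX; have lX' := lintS pr pr0 sub lX; have [pr1 _] := pr.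
have arce Y := adapted_point_atom pr (rce_adapted Y pr1).
split => // w; apply/integrableP; split.
  by apply/measurable_funTS/measurable_fun_adapted => //; exact: adapted_comp.
have [_ /(_ w)/integrableP[_]] := lX.
apply: le_lt_trans.
rewrite (_ : (\int[P]_(x in r0 w) `|(EFin \o X) x|)%E =
             (\int[P]_(x in r0 w) (rce r (fun v => `|X v|) x)%:E))%E.
  apply: le_integral_pos => //.
  - by case: pr0.
  - exact: (adapted_comp (fun x : R => `|x%:E|%E)).
  - exact: (adapted_comp EFin).
  - by move=> v; rewrite lee_fin rce_ge0.
  - by move=> v _; rewrite /= lee_fin norm_rce.
apply: (ge0_eq_integral_classes cT pr) => //.
- exact: saturated_sub.
- by apply: (adapted_comp (fun x : R => `|x%:E|%E)); case: lX.
- exact: (adapted_comp EFin).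
- by move=> v; rewrite lee_fin rce_ge0.
move=> v wv; rewrite (integral_class pr v (lint_adapted pr (rce_adapted _ pr1))).
rewrite [LHS](integral_class pr v (lint_norm pr lX')).
have [pw|/negPn/eqP pw] := boolP (P (r v) != 0%E); last by rewrite pw/= !mulr0.
have [u vu pu] := class_pos cT pr pw.
have aa Y := @rce_adapted r Y pr1.
by rewrite -(aa (rce r _) _ _ vu) (rce_id pr (rce_adapted _ pr1) pu) (aa _ _ _ vu).
Qed.

Lemma integral_rce_class X w : lint r0 X ->
  (\int[P]_(v in r0 w) (rce r X v)%:E = \int[P]_(v in r0 w) (X v)%:E)%E.
Proof.
move=> lX; have lX' := lintS pr pr0 sub lX; have [pr1 _] := pr.
apply: (eq_integral_classes cT pr).
- exact: saturated_sub.
- by have [_] := lint_rce lX; exact.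
- by have [_] := lX; exact.
move=> v wv; rewrite (integral_class pr v (lint_adapted pr (rce_adapted _ pr1))).
rewrite [RHS](integral_class pr v lX').
have [pw|/negPn/eqP pw] := boolP (P (r v) != 0%E); last by rewrite pw/= !mulr0.
have [u vu pu] := class_pos cT pr pw.
have aa Y := @rce_adapted r Y pr1.
by rewrite -(aa (rce r _) _ _ vu) (rce_id pr (rce_adapted _ pr1) pu) (aa _ _ _ vu).
Qed.

Lemma rce_tower X w : lint r0 X -> rce r0 (rce r X) w = rce r0 X w.
Proof. by move=> lX; rewrite /rce /Rintegral integral_rce_class. Qed.

End nested_partitions.

End conditional_expectation_on_classes.

(** * The chosen conditional expectation as an average over atoms *)

Section versions_of_conditional_expectation.
Context (R : realType) d (T : measurableType d) (P : probability T R).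
Hypothesis cT : countable [set: T].
Variable G : set (set T).
Hypotheses (sG : sigma_algebra [set: T] G) (mG : G `<=` measurable).

Lemma atom_in_sigma_algebra w : G (atom G w).
Proof. by have := @atom_measurable d T G cT w; rewrite sigma_algebra_id. Qed.

Lemma atom_measurable_partition : measurable_partition (atom G).
Proof.
split; first exact: atom_partition.
by move=> w; apply: mG; exact: atom_in_sigma_algebra.
Qed.

Lemma saturated_atom A : G A -> saturated (atom G) A.
Proof. by move=> GA w Aw v /(_ _ GA) <-. Qed.

Local Open Scope ereal_scope.

(** The extended-valued companion of [rce], for functions that may have infinite integral over a
    class. Null classes again get 0, because [0^-1 = 0]. *)
Definition cev r (X : T -> \bar R) (w : T) : \bar R :=
  (\int[P]_(v in r w) X v) * ((fine (P (r w)))^-1)%:E.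

Lemma cev_adapted r X : is_partition r -> adapted r (cev r X).
Proof. by move=> [_ h] w v /h; rewrite /cev => ->. Qed.

Lemma cev_rce r (X : T -> R) w : measurable_partition r -> lint P r X ->
  pos P w -> cev r (EFin \o X) w = (rce P r X w)%:E.
Proof.
move=> pr lX pw; rewrite /cev (integral_class pr w lX) -EFinM mulfK//.
by rewrite gt_eqF// pos_class.
Qed.

Lemma integral_cev_class r X w : measurable_partition r ->
  adapted point_atom X ->
  \int[P]_(v in r w) cev r X v = \int[P]_(v in r w) X v.
Proof.
move=> pr aX; have [[_ h] mr] := pr.
rewrite (eq_integral (cst (cev r X w))); last first.
  by move=> v; rewrite inE => /(cev_adapted X (proj1 pr)) ->.
have [pw|/negPn/eqP pw] := boolP (P (r w) != 0); last first.
  rewrite !null_set_integral//.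
  exact/measurable_funTS/measurable_fun_adapted.
have fw : fine (P (r w)) != 0%R by rewrite fine_eq0// class_measure_fin.
have Ep : P (r w) = (fine (P (r w)))%:E by rewrite fineK// class_measure_fin.
rewrite integral_cst// /cev [X in _ * X]Ep.
by rewrite -muleA -EFinM mulVf// mule1.
Qed.

(** [Y] is constant on the atom of [w], and the atom belongs to [G], so the defining identity tested
    on it determines the value. All versions therefore agree at positive points. *)
Lemma is_cond_expE X Y w : is_cond_exp P G X Y -> pos P w ->
  Y w = cev (atom G) X w.
Proof.
move=> [mY hY] pw; have pG := atom_measurable_partition.
have fw := pos_class cT pG pw.
have aY := adapted_atom mY.
rewrite /cev -hY; last exact: atom_in_sigma_algebra.
rewrite (eq_integral (cst (Y w))); last first.
  by move=> v; rewrite inE => /aY ->.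
rewrite integral_cst//; last by case: pG.
have Ep : P (atom G w) = (fine (P (atom G w)))%:E.
  by rewrite fineK// class_measure_fin//; case: pG.
rewrite [X in _ * X * _]Ep -muleA -EFinM.
by rewrite divff ?mule1// gt_eqF.
Qed.

(** [cond_exp] is selected by [xget], so its specification holds once some function meets it;
    [cev (atom G) X] is that witness. *)
Lemma cond_exp_spec X : adapted point_atom X ->
  (forall w, 0 <= X w) \/ P.-integrable setT X ->
  is_cond_exp P G X (cond_exp P G X).
Proof.
move=> aX hX; pose Q := [set Y | is_cond_exp P G X Y /\
    ((forall w, (0 <= X w)%E) -> forall w, (0 <= Y w)%E)].
suff : Q (cond_exp P G X) by case.
have pG := atom_measurable_partition; have pG1 := proj1 pG.
have acev := adapted_point_atom pG (cev_adapted X pG1).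
have ge0_cev U : (forall w, 0 <= U w) -> forall w, 0 <= cev (atom G) U w.
  move=> U0 w; apply: mule_ge0; first by apply: integral_ge0.
  by rewrite lee_fin invr_ge0 fine_ge0.
apply: (@xgetPex _ (cst 0) Q); exists (cev (atom G) X); split; last exact: ge0_cev.
split; first by apply: measurable_fun_atom => //; exact: cev_adapted.
move=> A GA; have sA := saturated_atom GA.
have key (v : T) : A v -> \int[P]_(w in atom G v) cev (atom G) X w =
  \int[P]_(w in atom G v) X w by move=> _; exact: integral_cev_class.
case: hX => [X0|iX].
  by apply: (ge0_eq_integral_classes cT pG) => //; exact: ge0_cev.
have mA := mG GA.
apply: (eq_integral_classes cT pG) => //; last exact: integrableS iX.
apply/integrableP; split; first exact/measurable_funTS/measurable_fun_adapted.
have /(integrableS measurableT mA (@subsetT _ A))/integrableP[_] := iX.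
apply: le_lt_trans.
apply: (@le_trans _ _ (\int[P]_(w in A) cev (atom G) (abse \o X) w)).
  apply: le_integral_pos => //.
  - exact: (adapted_comp abse).
  - exact/(adapted_point_atom pG)/cev_adapted.
  - by apply: ge0_cev => w; exact: abse_ge0.
  - move=> w _; rewrite /cev abseM; apply: lee_pmul => //.
      apply: le_abse_integral => //; first by case: pG.
      exact/measurable_funTS/measurable_fun_adapted.
    by rewrite /= ger0_norm// invr_ge0 fine_ge0.
rewrite le_eqVlt; apply/orP; left; apply/eqP.
apply: (ge0_eq_integral_classes cT pG) => //.
- exact/(adapted_point_atom pG)/cev_adapted.
- exact: (adapted_comp abse).
- by apply: ge0_cev => w; exact: abse_ge0.
- by move=> w _; apply: integral_cev_class => //; exact: (adapted_comp abse).
Qed.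

Lemma cond_expE X w : adapted point_atom X ->
  (forall w, 0 <= X w) \/ P.-integrable setT X -> pos P w ->
  cond_exp P G X w = cev (atom G) X w.
Proof. by move=> aX hX; exact/is_cond_expE/cond_exp_spec. Qed.

Lemma cond_exp_adapted X : adapted point_atom X ->
  (forall w, 0 <= X w) \/ P.-integrable setT X ->
  adapted (atom G) (cond_exp P G X).
Proof. by move=> aX hX; apply: adapted_atom; case: (cond_exp_spec aX hX). Qed.

Lemma cond_exp_rce (X : T -> R) w : lint P (fun=> setT) X -> pos P w ->
  cond_exp P G (EFin \o X) w = (rce P (atom G) X w)%:E.
Proof.
move=> [aX iX] pw; have pG := atom_measurable_partition.
rewrite cond_expE//; first last.
- by right; exact: (iX w).
- exact: adapted_comp.
rewrite cev_rce//; split => // v; apply: integrableS (iX w) => //.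
by case: pG.
Qed.

End versions_of_conditional_expectation.

(** * Condition (F4) and conditional independence *)

Section filtration_partitions.
Context (R : realType) d (T : measurableType d) (P : probability T R).
Hypothesis cT : countable [set: T].
Variable F : nat -> nat -> set (set T).
Hypothesis hF : biparameter_filtration F.
Hypothesis F4 : F4_condition P F.

Let F0 i j : (i == 0)%N || (j == 0)%N -> filtration0 F i j = [set set0; setT].
Proof. by rewrite /filtration0 => ->. Qed.

Let F1 i j : (1 <= i)%N -> (1 <= j)%N -> filtration0 F i j = F i j.
Proof. by rewrite /filtration0 !lt0n => /negbTE -> /negbTE ->. Qed.

(* [rF], [rm] and [rG N] are the partitions into the atoms of F_{i,j}, of
   F^-_{i,j} and of F_{i-1,N} \/ F_{i,j-1}; the latter is the past of (i,j) for
   the lexicographic order on the N x N grid. *)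
Definition rF i j : T -> set T := atom (filtration0 F i j).
Definition rm i j : T -> set T := fun w => rF i.-1 j w `&` rF i j.-1 w.
Definition rG N i j : T -> set T := fun w => rF i.-1 N w `&` rF i j.-1 w.

Lemma atom_Fminus i j : atom (Fminus F i j) = rm i j.
Proof. by rewrite /Fminus atom_generated; apply/funext => w; rewrite atomU. Qed.

Lemma rF0 i j : (i == 0)%N || (j == 0)%N -> rF i j = fun=> setT.
Proof.
by move=> h; rewrite /rF F0//; apply/funext => w; rewrite atom_trivial.
Qed.

Lemma setT_partition : measurable_partition (fun=> [set: T]).
Proof. by split. Qed.

Lemma rF_partition i j : measurable_partition (rF i j).
Proof.
have [h|] := boolP ((i == 0)%N || (j == 0)%N).
  by rewrite rF0//; exact: setT_partition.
rewrite negb_or -!lt0n => /andP[i0 j0]; rewrite /rF F1//.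
apply: atom_measurable_partition => //.
  exact: (bf_sigma_algebra hF).
exact: (bf_sub_measurable hF).
Qed.

Lemma rm_partition i j : measurable_partition (rm i j).
Proof. by apply: measurable_partitionI; exact: rF_partition. Qed.

Lemma rG_partition N i j : measurable_partition (rG N i j).
Proof. by apply: measurable_partitionI; exact: rF_partition. Qed.

Lemma rF_sub i j i' j' w : (i <= i')%N -> (j <= j')%N ->
  rF i' j' w `<=` rF i j w.
Proof.
move=> ii jj; have [h|] := boolP ((i == 0)%N || (j == 0)%N).
  by rewrite (rF0 h).
rewrite negb_or -!lt0n => /andP[i0 j0].
have i'0 := leq_trans i0 ii; have j'0 := leq_trans j0 jj.
rewrite /rF !F1//; apply: atomS.
apply: (@subset_trans _ (F i j')).
  elim: j' jj {j'0} => [|j' ih]; first by rewrite leqn0 => /eqP ->.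
  rewrite leq_eqVlt => /orP[/eqP -> //|jj]; apply: subset_trans (ih jj) _.
  by apply: (bf_mono_r hF) => //; exact: leq_trans j0 jj.
elim: i' ii {i'0} => [|i' ih]; first by rewrite leqn0 => /eqP ->.
rewrite leq_eqVlt => /orP[/eqP -> //|ii]; apply: subset_trans (ih ii) _.
by apply: (bf_mono_l hF) => //; exact: leq_trans i0 ii.
Qed.

Lemma rG_rm N i j w : (j <= N)%N -> rG N i j w `<=` rm i j w.
Proof. by move=> jN v [a b]; split => //; apply: rF_sub a. Qed.

Lemma rF_rm i j w : rF i j w `<=` rm i j w.
Proof. by move=> v a; split; apply: rF_sub a => //; exact: leq_pred. Qed.

Lemma lintT_rF i j X : lint P (fun=> setT) X -> lint P (rF i j) X.
Proof.
by move=> lX; apply: lintS lX => //; exact: rF_partition.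
Qed.

(** (F4) as a pointwise identity between averages at positive points. Zero indices are included:
    there the partition is trivial, and the claim reduces to averaging a constant or to the tower
    property. *)
Lemma rce_F4 i j i' j' X w : lint P (fun=> setT) X -> pos P w ->
  rce P (rF i' j') (rce P (rF i j) X) w =
  rce P (rF (minn i i') (minn j j')) X w.
Proof.
move=> lX pw.
have [h|] := boolP ((i == 0)%N || (j == 0)%N).
  rewrite (rF0 h) (_ : rF (minn _ _) _ = (fun=> setT)).
    have <- := rce_cst cT (rF_partition i' j') (rce P (fun=> setT) X w) pw.
    by apply: eq_rce => //; exact: rF_partition.
  by apply: rF0; case/orP: h => /eqP ->; rewrite ?min0n// orbT.
rewrite negb_or -!lt0n => /andP[i0 j0].
have [h|] := boolP ((i' == 0)%N || (j' == 0)%N).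
  rewrite (rF0 h) (_ : rF (minn _ _) _ = (fun=> setT)).
    by rewrite rce_tower//; exact: rF_partition.
  by apply: rF0; case/orP: h => /eqP ->; rewrite ?minn0// orbT.
rewrite negb_or -!lt0n => /andP[i'0 j'0].
have [_ /(_ w) iX] := lX.
have := pos_ae cT (F4 i0 j0 i'0 j'0 iX) pw.
have sA a b : (1 <= a)%N -> (1 <= b)%N -> sigma_algebra [set: T] (F a b).
  exact: (bf_sigma_algebra hF).
have mA a b : (1 <= a)%N -> (1 <= b)%N -> F a b `<=` measurable.
  exact: (bf_sub_measurable hF).
have m0 : (1 <= minn i i')%N by rewrite leq_min i0.
have n0 : (1 <= minn j j')%N by rewrite leq_min j0.
rewrite [in X in _ = X]cond_exp_rce//; [|exact: sA|exact: mA].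
have aX : adapted point_atom (EFin \o X) by apply: adapted_comp; case: lX.
have aC : adapted point_atom (cond_exp P (F i j) (EFin \o X)).
  apply: adapted_point_atom (rF_partition i j) _.
  rewrite /rF F1//; apply: cond_exp_adapted => //;
    [exact: sA|exact: mA|by right].
have eC v : pos P v ->
    (rce P (rF i j) X v)%:E = cond_exp P (F i j) (EFin \o X) v.
  by move=> pv; rewrite cond_exp_rce// ?[in RHS]/rF ?F1//;
    [rewrite /rF F1|exact: sA|exact: mA].
have lr : lint P (fun=> setT) (rce P (rF i j) X).
  by apply: lint_rce => //; exact: rF_partition.
have [ar ir] := lr.
have ar' : adapted point_atom (EFin \o rce P (rF i j) X) by exact: adapted_comp.
rewrite cond_expE//; [|exact: sA|exact: mA|]; last first.
- by right; apply: eq_integrable_pos (ir w) => //; exact: adapted_comp.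
move=> E; apply: EFin_inj.
rewrite [in RHS]/rF F1// -E -(cev_rce cT (rF_partition _ _))//; last first.
  exact: lintT_rF.
rewrite /cev [in LHS](_ : rF i' j' = atom (F i' j')); last by rewrite /rF F1.
congr (_ * _)%E; apply: eq_integral_pos => //.
  by have [_] := rF_partition i' j'; rewrite /rF F1//; exact.
Qed.

End filtration_partitions.

(** * Conditional independence of F_{i,j} and the lexicographic past *)

Section conditional_independence.
Context (R : realType) d (T : measurableType d) (P : probability T R).
Hypothesis cT : countable [set: T].
Variable F : nat -> nat -> set (set T).
Hypothesis hF : biparameter_filtration F.
Hypothesis F4 : F4_condition P F.

Local Notation rF := (rF F).
Local Notation rm := (rm F).
Local Notation rG := (rG F).

Section fixed_indices.
Variables N i j : nat.
Hypotheses (i1 : (1 <= i)%N) (jN : (j <= N)%N).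

Let pF a b := rF_partition cT hF a b.
Let pm := rm_partition cT hF i j.
Let pG := rG_partition cT hF N i j.

Let lint_rG X : lint P (rm i j) X -> lint P (rG N i j) X.
Proof. by apply: lintS => // w; exact: rG_rm. Qed.

(* (F4) applied to the restriction of [Y] to a class [c `&` d] of [rm]: the
   averages over [b] and over [c] agree, where [b `<=` c] are the classes of
   F_{i-1,N} and F_{i-1,j}. *)
Let average_rF (Y : T -> R) w : adapted (rF i j) Y ->
  P.-integrable (rm i j w) (EFin \o Y) -> pos P w ->
  (\int[P]_(v in rG N i j w) Y v) / fine (P (rF i.-1 N w)) =
  (\int[P]_(v in rm i j w) Y v) / fine (P (rF i.-1 j w)).
Proof.
move=> aY iY pw.
have [_ mm] := pm; have [_ mG] := pG.
have sub_b : rF i.-1 N w `<=` rF i.-1 j w by exact: rF_sub.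
pose Y' := Y \_ (rm i j w).
have aY' : adapted (rF i j) Y'.
  move=> u v uv; rewrite /Y' !patchE (aY _ _ uv).
  have [[_ h] _] := pm.
  have uv' := rF_rm hF uv.
  congr (if _ then _ else _); apply/idP/idP; rewrite !inE => wv.
    by rewrite -(h _ _ wv); apply: partition_sym (proj1 pm) _ _ uv'.
  by rewrite -(h _ _ wv).
have lY' : lint P (fun=> setT) Y'.
  split=> [|_]; first exact: adapted_point_atom (pF i j) aY'.
  rewrite (_ : EFin \o Y' = (EFin \o Y) \_ (rm i j w)).
    by rewrite -integrable_mkcond.
  by apply/funext => v; rewrite /Y' /= !patchE; case: ifP.
have := rce_F4 cT hF F4 i j i.-1 N lY' pw.
rewrite (minn_idPr (leq_pred i)) (minn_idPl jN).
rewrite (@eq_rce _ _ _ _ cT _ (pF i.-1 N) _ Y') //; last 3 first.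
- exact: adapted_point_atom (pF _ _) (rce_adapted P _ (proj1 (pF _ _))).
- by case: lY'.
- by move=> v pv _; exact: (rce_id cT (pF _ _)).
rewrite /rce -!Rintegral_mkcondr.
rewrite (_ : rF i.-1 N w `&` rm i j w = rG N i j w); last first.
  apply/seteqP; split => v; first by case=> a [].
  by case=> a b; split => //; split => //; exact: sub_b.
by rewrite (_ : rF i.-1 j w `&` rm i j w = rm i j w)// setIA setIid.
Qed.

(** [average_rF] for [Y] is divided by [average_rF] for the constant 1; the measures of the classes
    of F_{i-1,N} and F_{i-1,j} cancel. *)
Lemma rce_rG_rm (Y : T -> R) w : adapted (rF i j) Y -> lint P (rm i j) Y ->
  pos P w -> rce P (rG N i j) Y w = rce P (rm i j) Y w.
Proof.
move=> aY lY pw.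
have := average_rF aY (proj2 lY w) pw.
have := average_rF (@adapted_cst _ (rF i j) _ (1 : R)) (proj2 (lint_cst P pm 1) w) pw.
rewrite !Rintegral_cst//; [|exact: (proj2 pm)|exact: (proj2 pG)].
have := pos_class cT pG pw; have := pos_class cT pm pw.
have := pos_class cT (pF i.-1 N) pw; have := pos_class cT (pF i.-1 j) pw.
rewrite /rce !mul1r.
move: (fine _) (fine _) (fine _) (fine _) => c b m g c0 b0 m0 g0.
move: (Rintegral _ _ _) (Rintegral _ _ _) => x y.
move: (c0) (b0) (m0) (g0); rewrite !lt0r.
move=> /andP[cn _] /andP[bn _] /andP[mn _] /andP[gn _].
move=> /eqP; rewrite eqr_div// => /eqP e1.
move=> /eqP; rewrite eqr_div// => /eqP e2.
apply/eqP; rewrite eqr_div//; apply/eqP.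
apply: (@mulfI _ (g * m)); first by rewrite mulf_neq0.
transitivity ((y * g) * (b * m)); first by ring.
rewrite e2 -e1; ring.
Qed.

(** The working form of conditional independence: the average is taken over F^-_{i,j}, while the
    weight [Z] may depend on the whole lexicographic past. *)
Lemma integral_rce_rm (X Z : T -> R) :
  (forall w, 0 <= X w) -> (forall w, 0 <= Z w) ->
  adapted (rF i j) X -> lint P (rm i j) X -> adapted (rG N i j) Z ->
  (\int[P]_w (rce P (rm i j) X w * Z w)%:E = \int[P]_w (X w * Z w)%:E)%E.
Proof.
move=> X0 Z0 aX lX aZ; rewrite -(ge0_integral_rce cT pG X0 Z0) //; last exact: lint_rG.
have aZ' := adapted_point_atom pG aZ.
apply: eq_integral_pos => //.
- apply: (adapted_comp2 (fun x y => (x * y)%:E)) => //.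
  exact: adapted_point_atom pm (rce_adapted P _ (proj1 pm)).
- apply: (adapted_comp2 (fun x y => (x * y)%:E)) => //.
  exact: adapted_point_atom pG (rce_adapted P _ (proj1 pG)).
- by move=> w pw; rewrite rce_rG_rm.
Qed.

(** The symmetric half of conditional independence. [integral_rce_rm] is tested on the indicator [I]
    of a class of [rF i j], and the averaging is moved from [I] to [Z]. *)
Lemma rce_rF_rm (Z : T -> R) w : (forall w, 0 <= Z w) ->
  adapted (rG N i j) Z -> lint P (rm i j) Z -> pos P w ->
  rce P (rF i j) Z w = rce P (rm i j) Z w.
Proof.
move=> Z0 aZ lZ pw; have [_ mF] := pF i j.
set a := rF i j w; pose I : T -> R := \1_a.
have I0 v : 0 <= I v by rewrite /I indicE.
have aI : adapted (rF i j) I.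
  move=> u v uv; rewrite /I !indicE; congr (_%:R); congr nat_of_bool.
  have [[_ h] _] := pF i j.
  apply/idP/idP; rewrite !inE => wv; rewrite /a -(h _ _ wv).
    by apply: partition_sym (proj1 (pF i j)) _ _ uv.
  by [].
have am : adapted point_atom (rce P (rm i j) Z).
  exact: adapted_point_atom pm (rce_adapted P _ (proj1 pm)).
have aI' := adapted_point_atom (pF i j) aI.
have lI : lint P (rm i j) I.
  apply: (lint_le cT pm aI' _ (lint_cst P pm 1)) => v _.
  by rewrite normr1 /I indicE; case: (_ \in _); rewrite ?normr1 ?normr0.
have mZ : measurable_fun setT Z.
  by apply: measurable_fun_adapted => //; exact: adapted_point_atom pG aZ.
have E (X : T -> R) : (\int[P]_w (I w * X w)%:E = \int[P]_(w in a) (X w)%:E)%E.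
  rewrite [RHS]integral_mkcond; apply: eq_integral => v _.
  by rewrite patchE /I indicE; case: ifP; rewrite ?mul1r ?mul0r.
have C (X Y : T -> R) : (\int[P]_w (X w * Y w)%:E = \int[P]_w (Y w * X w)%:E)%E.
  by apply: eq_integral => v _; rewrite mulrC.
have lZ' : lint P (rF i j) Z.
  by apply: lintS lZ => // v; exact: rF_rm.
have lm : lint P (rF i j) (rce P (rm i j) Z).
  have := lint_adapted P pm (rce_adapted P Z (proj1 pm)).
  apply: lintS => // v.
  exact: rF_rm.
have g0 (X : T -> R) : (forall v, 0 <= X v) -> forall v, 0 <= rce P (rm i j) X v.
  by move=> X0 v; exact: rce_ge0.
have := integral_rce_rm I0 Z0 aI lI aZ.
rewrite C -(ge0_integral_rce cT pm Z0 (g0 _ I0) lZ (rce_adapted P I (proj1 pm))).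
rewrite C (ge0_integral_rce cT pm I0 (g0 _ Z0) lI (rce_adapted P Z (proj1 pm))).
rewrite !E (integral_class (pF i j) w lZ') (integral_class (pF i j) w lm).
have pa : fine (P (rF i j w)) != 0 by rewrite gt_eqF// pos_class.
move=> [] /(mulIf pa) <-; rewrite rce_id//.
by move=> u v uv; exact: (rce_adapted P Z (proj1 pm) (rF_rm hF uv)).
Qed.

(** Factors the average over F^-_{i,j} through the lexicographic past, along which the partitions do
    become finer and Doob's inequality applies. *)
Lemma rce_rm_rF (Y : T -> R) w : (forall w, 0 <= Y w) ->
  lint P (fun=> setT) Y -> pos P w ->
  rce P (rm i j) Y w = rce P (rF i j) (rce P (rG N i j) Y) w.
Proof.
move=> Y0 lY pw.
have lm : lint P (rm i j) Y by apply: lintS lY => //; exact: setT_partition.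
have sub v : rG N i j v `<=` rm i j v by exact: rG_rm.
rewrite rce_rF_rm//.
- by rewrite rce_tower.
- by move=> v; exact: rce_ge0.
- exact: (rce_adapted P Y (proj1 pG)).
- exact: lint_rce.
Qed.

End fixed_indices.
End conditional_independence.

(** * One-parameter inequalities *)

(** The maximum of 0 and of [y 0], ..., [y (K-1)]; the entry [y K] is excluded. *)
Fixpoint runmax (R : realType) (y : nat -> R) K :=
  if K is K'.+1 then Num.max (runmax y K') (y K') else 0.

Section means.
Context (R : realType) d (T : measurableType d) (P : probability T R).
Hypothesis cT : countable [set: T].
Implicit Types X Y : T -> R.

Definition mean X : \bar R := (\int[P]_w (X w)%:E)%E.

(* Adaptedness to the point atoms amounts to measurability. *)
Definition nonneg X := adapted point_atom X /\ forall w, 0 <= X w.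

Lemma nonnegD X Y : nonneg X -> nonneg Y -> nonneg (fun w => X w + Y w).
Proof.
move=> [aX X0] [aY Y0]; split; first exact: adapted_comp2.
by move=> w; exact: addr_ge0.
Qed.

Lemma nonnegM X Y : nonneg X -> nonneg Y -> nonneg (fun w => X w * Y w).
Proof.
move=> [aX X0] [aY Y0]; split; first exact: (adapted_comp2 (fun x y => x * y)).
by move=> w; exact: mulr_ge0.
Qed.

Lemma nonneg_comp X (g : R -> R) : adapted point_atom X ->
  (forall x, 0 <= g x) -> nonneg (fun w => g (X w)).
Proof. by move=> aX h; split => //; exact: adapted_comp. Qed.

Lemma nonneg_cst (c : R) : 0 <= c -> nonneg (fun=> c).
Proof. by split. Qed.

Lemma nonneg_sum I (s : seq I) (X : I -> T -> R) :
  (forall i, nonneg (X i)) -> nonneg (fun w => \sum_(i <- s) X i w).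
Proof.
move=> h; split; first by apply: adapted_sum => i _; case: (h i).
by move=> w; apply: sumr_ge0 => i _; case: (h i).
Qed.

Lemma runmax_ge0 (y : nat -> R) K : 0 <= runmax y K.
Proof. by elim: K => //= K ih; rewrite le_max ih. Qed.

Lemma le_runmax (y : nat -> R) k K : (k < K)%N -> y k <= runmax y K.
Proof.
elim: K => // K ih; rewrite ltnS leq_eqVlt /= le_max => /orP[/eqP ->|/ih ->//].
by rewrite lexx orbT.
Qed.

Lemma runmax_homo (y : nat -> R) k K : (k <= K)%N -> runmax y k <= runmax y K.
Proof.
elim: K => [|K ih]; first by rewrite leqn0 => /eqP ->.
rewrite leq_eqVlt => /orP[/eqP -> //|/ih h].
by rewrite /= le_max h.
Qed.

Lemma adapted_runmax (r : T -> set T) (X : nat -> T -> R) K :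
  (forall k, (k < K)%N -> adapted r (X k)) ->
  adapted r (fun w => runmax (X^~ w) K).
Proof.
elim: K => [//|K ih] h w v wv /=.
by rewrite (ih _ _ _ wv) ?(h _ _ _ _ wv)// => k kK; apply: h; exact: ltnW.
Qed.

Lemma nonneg_runmax (X : nat -> T -> R) K :
  (forall k, (k < K)%N -> adapted point_atom (X k)) ->
  nonneg (fun w => runmax (X^~ w) K).
Proof.
by move=> h; split=> [|w]; [exact: adapted_runmax|exact: runmax_ge0].
Qed.

Lemma nonneg_sqr X : adapted point_atom X -> nonneg (fun w => X w ^+ 2).
Proof.
move=> aX; split => [|w]; last exact: sqr_ge0.
exact: (adapted_comp (fun x => x ^+ 2)).
Qed.

Let mf X : nonneg X -> measurable_fun setT (EFin \o X).
Proof. by move=> [aX _]; apply: measurable_fun_adapted => //; exact: adapted_comp. Qed.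

Local Open Scope ereal_scope.

Lemma mean_ge0 X : nonneg X -> 0 <= mean X.
Proof. by move=> [_ X0]; apply: integral_ge0 => w _; rewrite lee_fin. Qed.

Lemma le_mean X Y : nonneg X -> nonneg Y ->
  (forall w, pos P w -> (X w <= Y w)%R) -> mean X <= mean Y.
Proof.
move=> [aX X0] [aY Y0] h; apply: le_integral_pos => //; try exact: adapted_comp.
Qed.

Lemma meanD X Y : nonneg X -> nonneg Y ->
  mean (fun w => X w + Y w)%R = mean X + mean Y.
Proof.
move=> nX nY; rewrite /mean; under eq_integral do rewrite EFinD.
by case: (nX) => _ X0; case: (nY) => _ Y0; apply: ge0_integralD => //;
  [move=> w _; rewrite lee_fin|exact: mf|move=> w _; rewrite lee_fin|exact: mf].
Qed.

Lemma meanZ X (c : R) : nonneg X -> (0 <= c)%R ->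
  mean (fun w => c * X w)%R = c%:E * mean X.
Proof.
move=> nX c0; rewrite /mean; under eq_integral do rewrite EFinM.
by case: (nX) => _ X0; apply: ge0_integralZl => //;
  [exact: mf|move=> w _; rewrite lee_fin].
Qed.

Lemma mean_cst (c : R) : mean (fun=> c) = c%:E.
Proof. by rewrite /mean integral_cst// [X in (_ * X)%E]probability_setT mule1. Qed.

Lemma mean_sum I (s : seq I) (X : I -> T -> R) : (forall i, nonneg (X i)) ->
  mean (fun w => \sum_(i <- s) X i w)%R = \sum_(i <- s) mean (X i).
Proof.
move=> h; elim: s => [|i s ih].
  rewrite big_nil -[RHS](mean_cst 0); congr mean.
  by apply/funext => w; rewrite big_nil.
rewrite big_cons -ih -meanD//; last exact: nonneg_sum.
by congr mean; apply/funext => w; rewrite big_cons.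
Qed.

Lemma lintT_mean X : nonneg X -> mean X < +oo -> lint P (fun=> setT) X.
Proof.
move=> nX fX; have [aX X0] := nX; split => // _; apply/integrableP; split.
  exact: mf.
rewrite (eq_integral (EFin \o X))// => w _.
by rewrite /= ger0_norm.
Qed.

Lemma mean_rceM r X Y : measurable_partition r -> nonneg X -> nonneg Y ->
  lint P r X -> adapted r Y ->
  mean (fun w => rce P r X w * Y w)%R = mean (fun w => X w * Y w)%R.
Proof. by move=> pr [_ X0] [_ Y0] lX aY; exact: ge0_integral_rce. Qed.

End means.

Section predictable_comparison.
Context (R : realType) d (T : measurableType d) (P : probability T R).
Hypothesis cT : countable [set: T].

(** A discrete form of the integral of A^{-1/2} dA being 2 A^{1/2}. With [A] the previous partial
    sum, [a K] is the product of the difference and the sum of [sqrt (A + a K)] and [sqrt A]; the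
    sum is at most [2 * sqrt (D K)], and the differences telescope. *)
Lemma sum_div_sqrt_le (a D : nat -> R) K : (forall k, 0 <= a k) ->
  (forall k, 0 < D k) ->
  (forall k, (k < K)%N -> \sum_(l < k.+1) a l <= D k) ->
  \sum_(k < K) a k / Num.sqrt (D k) <= 2 * Num.sqrt (\sum_(k < K) a k).
Proof.
move=> a0 D0; elim: K => [|K ih] h; first by rewrite !big_ord0 sqrtr0 mulr0.
rewrite big_ord_recr /=; apply: le_trans (lerD (ih _) (lexx _)) _.
  by move=> k kK; apply: h; exact: ltnW.
have := h K (ltnSn K); rewrite big_ord_recr /=.
have A0 : 0 <= \sum_(k < K) a k by apply: sumr_ge0.
move: (\sum_(k < K) a k) A0 => A A0 AD.
have sD : 0 < Num.sqrt (D K) by rewrite sqrtr_gt0.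
have : a K / Num.sqrt (D K) <= 2 * (Num.sqrt (A + a K) - Num.sqrt A).
  rewrite ler_pdivrMr//.
  have e : a K = (Num.sqrt (A + a K) - Num.sqrt A) *
                 (Num.sqrt (A + a K) + Num.sqrt A).
    rewrite -subr_sqr !sqr_sqrtr ?addr_ge0//; ring.
  have h1 : Num.sqrt (A + a K) <= Num.sqrt (D K) by apply: ler_wsqrtr.
  have h2 : Num.sqrt A <= Num.sqrt (A + a K) by apply: ler_wsqrtr; rewrite lerDl.
  rewrite {1}e; nra.
lra.
Qed.

(** With [B] the sum of the [b k], [2 * sqrt B <= B / sqrt M + sqrt M], and [B / sqrt M] is at most
    the sum of [b k / sqrt (D k)]. Under the mean, [b] is exchanged for [a], and [sum_div_sqrt_le]
    bounds the result by [2 * sqrt M]; hence (2 + 1) / 2. *)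
Lemma mean_sqrt_sum_le (a b D : nat -> T -> R) (M : T -> R) K :
  (forall k, nonneg (a k)) -> (forall k, nonneg (b k)) ->
  (forall k, nonneg (D k)) -> nonneg M ->
  (forall k w, 0 < D k w) -> (forall w, 0 < M w) ->
  (forall k w, (k < K)%N -> D k w <= M w) ->
  (forall k w, (k < K)%N -> \sum_(l < k.+1) a l w <= D k w) ->
  (forall k, (k < K)%N ->
    (mean P (fun w => (b k w * (Num.sqrt (D k w))^-1)%R) <=
     mean P (fun w => (a k w * (Num.sqrt (D k w))^-1)%R))%E) ->
  (mean P (fun w => (Num.sqrt (\sum_(k < K) b k w))%R) <=
   (3 / 2)%:E * mean P (fun w => (Num.sqrt (M w))%R))%E.
Proof.
move=> na nb nD nM D0 M0 DM aD hab.
have nsq X : nonneg X -> nonneg (fun w : T => Num.sqrt (X w)).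
  by move=> [aX _]; apply: nonneg_comp => // x; exact: sqrtr_ge0.
have nisq X : nonneg X -> nonneg (fun w : T => (Num.sqrt (X w))^-1).
  move=> [aX _]; split=> [|w]; last by rewrite invr_ge0 sqrtr_ge0.
  exact: (adapted_comp (fun x => (Num.sqrt x)^-1)).
have nab (c : nat -> T -> R) : (forall k, nonneg (c k)) -> forall k : nat,
    nonneg (fun w => c k w * (Num.sqrt (D k w))^-1).
  by move=> nc k; apply: nonnegM => //; exact: nisq.
have nS (c : nat -> T -> R) : (forall k, nonneg (c k)) ->
    nonneg (fun w => \sum_(k < K) c k w).
  by move=> nc; exact: (@nonneg_sum _ _ _ _ _ (fun k : 'I_K => c k)).
have nSb := nS _ (nab b nb); have nSa := nS _ (nab a na).
have h1 : (mean P (fun w => (Num.sqrt (\sum_(k < K) b k w))%R) <=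
  mean P (fun w => (2^-1 * ((\sum_(k < K) b k w * (Num.sqrt (D k w))^-1) +
                        Num.sqrt (M w)))%R))%E.
  apply: le_mean => //; first exact/nsq/nS.
    apply: nonnegM; first by apply: nonneg_cst; lra.
    by apply: nonnegD => //; exact: nsq.
  move=> w _; set B := \sum_(k < K) b k w.
  have B0 : 0 <= B by apply: sumr_ge0 => k _; case: (nb k).
  have sM : 0 < Num.sqrt (M w) by rewrite sqrtr_gt0.
  have : B / Num.sqrt (M w) <= \sum_(k < K) b k w * (Num.sqrt (D k w))^-1.
    rewrite /B mulr_suml; apply: ler_sum => k _; apply: ler_wpM2l.
      by case: (nb k).
    rewrite lef_pV2 ?posrE ?sqrtr_gt0//; apply: ler_wsqrtr; exact: DM.
  have : 2 * Num.sqrt B <= B / Num.sqrt (M w) + Num.sqrt (M w).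
    rewrite -(ler_pM2r sM) [leRHS]mulrDl divfK ?gt_eqF//.
    have := sqr_ge0 (Num.sqrt B - Num.sqrt (M w)); rewrite -{3}(sqr_sqrtr B0).
    by rewrite sqrrB; lra.
  lra.
apply: le_trans h1 _.
rewrite meanZ//; last by apply: nonnegD => //; exact: nsq.
rewrite meanD//; last exact: nsq.
rewrite (@mean_sum _ _ _ _ cT _ _ (fun k : 'I_K => _)); last by move=> k; exact: nab.
have h2 : (\sum_(k < K) mean P (fun w => (b k w * (Num.sqrt (D k w))^-1)%R) <=
           2%:E * mean P (fun w => (Num.sqrt (M w))%R))%E.
  apply: (@le_trans _ _
    (\sum_(k < K) mean P (fun w => (a k w * (Num.sqrt (D k w))^-1)%R))%E).
    by apply: lee_sum => k _; exact: hab.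
  rewrite -(@mean_sum _ _ _ _ cT _ _ (fun k : 'I_K => _)); last by move=> k; exact: nab.
  rewrite -meanZ//; last exact: nsq.
  apply: le_mean => //.
    by apply: nonnegM; [exact: nonneg_cst|exact: nsq].
  move=> w _.
  apply: (le_trans (@sum_div_sqrt_le (a^~ w) (D^~ w) K _ _ _)) => //.
  - by move=> k; case: (na k).
  - by move=> k kK; exact: aD.
  rewrite ler_pM2l//; apply: ler_wsqrtr.
  case: K {nS nSa nSb hab} aD DM => [|K] aD DM; first by rewrite big_ord0 ltW.
  exact: le_trans (aD K w (ltnSn _)) (DM K w (ltnSn _)).
apply: (@le_trans _ _ (2^-1%:E * (2%:E * mean P (fun w => (Num.sqrt (M w))%R) +
  mean P (fun w => (Num.sqrt (M w))%R)))%E).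
  by apply: lee_wpmul2l; [rewrite lee_fin|exact: leeD2r].
have m0 : (0 <= mean P (fun w => (Num.sqrt (M w))%R))%E by apply/mean_ge0/nsq.
move: (mean _ _) m0 => m m0.
have -> : (2%:E * m + m = 3%:E * m)%E.
  rewrite -[X in (_ + X)%E]mul1e -ge0_muleDl//; congr (_ * _)%E.
  by rewrite (_ : 3 = 2 + 1 :> R) ?EFinD//; ring.
rewrite muleA -EFinM le_eqVlt; apply/orP; left; apply/eqP.
by congr (_%:E * _)%E; field.
Qed.

End predictable_comparison.

(** * Doob's maximal inequality in L^2 *)

Section doob.
Context (R : realType) d (T : measurableType d) (P : probability T R).
Hypothesis cT : countable [set: T].
Variable r : nat -> T -> set T.
Hypothesis pr : forall k, measurable_partition (r k).
Hypothesis r_sub : forall k l w, (k <= l)%N -> r l w `<=` r k w.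
Variable Y : T -> R.
Hypotheses (nY : nonneg Y) (fY : (mean P (fun w => (Y w ^+ 2)%R) < +oo)%E).

Let y k := rce P (r k) Y.
Let m K w := runmax (y^~ w) K.

Let nsqr (X : T -> R) : nonneg X -> nonneg (fun w => X w ^+ 2).
Proof. by case=> aX _; exact: nonneg_sqr. Qed.

Lemma lintT_of_sqr (X : T -> R) : nonneg X -> (mean P (fun w => (X w ^+ 2)%R) < +oo)%E ->
  lint P (fun=> setT) X.
Proof.
move=> nX fX; have [aX X0] := nX; apply: lintT_mean => //.
apply: (@le_lt_trans _ _ (mean P (fun w => 1 + X w ^+ 2)%R)).
  apply: le_mean => //; first by apply: nonnegD; [exact: nonneg_cst|exact: nsqr].
  by move=> w _; have := sqr_ge0 (X w - 1); have := X0 w; nra.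
rewrite (meanD P cT (nonneg_cst T (ler01 : 0 <= 1 :> R)) (nsqr nX)).
by rewrite mean_cst lte_add_pinfty// ltry.
Qed.

Let lY := lintT_of_sqr nY fY.
Let lY2 := lintT_mean cT (nsqr nY) fY.

Let ny k : nonneg (y k).
Proof.
split; first exact: adapted_point_atom (pr k) (rce_adapted P Y (proj1 (pr k))).
by move=> w; apply: rce_ge0; case: nY.
Qed.

Let nm K : nonneg (m K).
Proof. by apply: nonneg_runmax => k _; case: (ny k). Qed.

Let am K k : (K <= k.+1)%N -> adapted (r k) (m K).
Proof.
move=> Kk; apply: adapted_runmax => l lK w v wv.
apply: (rce_adapted P Y (proj1 (pr l))); apply: r_sub wv.
by rewrite -ltnS (leq_trans lK).
Qed.

Let lr k (X : T -> R) : lint P (fun=> setT) X -> lint P (r k) X.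
Proof. by apply: lintS => //; exact: setT_partition. Qed.

Let mean_my k K : (K <= k.+1)%N ->
  mean P (fun w => y k w * m K w) = mean P (fun w => Y w * m K w).
Proof. by move=> Kk; apply: mean_rceM => //; [exact: lr|exact: am]. Qed.

(** Finiteness is what permits subtracting these means later. The crude bound by the sum of all
    [y k ^+ 2] suffices, each mean being controlled by Jensen. *)
Let m_fin K : (mean P (fun w => (m K w ^+ 2)%R) < +oo)%E.
Proof.
apply: (@le_lt_trans _ _ (mean P (fun w => \sum_(k < K) y k w ^+ 2)%R)).
  apply: le_mean => //; first exact: nsqr.
    by apply: (@nonneg_sum _ _ _ _ _ (fun (k : 'I_K) w => y k w ^+ 2)) => k; exact: nsqr.
  move=> w _; rewrite /m; elim: K => [|K ih].
    by rewrite big_ord0 expr0n.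
  rewrite big_ord_recr /=.
  have [_ /(_ w) a] := nm K; have [_ /(_ w) b] := ny K; rewrite /m in a.
  have s0 : 0 <= \sum_(k < K) y k w ^+ 2 by apply: sumr_ge0 => k _; exact: sqr_ge0.
  have b2 := sqr_ge0 (y K w).
  by case: (leP (runmax (y^~ w) K) (y K w)) => _; lra.
rewrite (@mean_sum _ _ _ _ cT _ _ (fun (k : 'I_K) w => (y k w ^+ 2)%R));
  last by move=> k; exact: nsqr.
apply: lte_sum_pinfty => k _.
apply: (@le_lt_trans _ _ (mean P (fun w => Y w ^+ 2)%R)) => //.
apply: (@le_trans _ _ (mean P (rce P (r k) (fun w => Y w ^+ 2)))).
  apply: le_mean => //; first exact: nsqr.
    split; first exact: adapted_point_atom (pr k) (rce_adapted P _ (proj1 (pr k))).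
    by move=> w; apply: rce_ge0 => v; exact: sqr_ge0.
  by move=> w pw; apply: rce_sqr => //; exact: lr.
have := mean_rceM cT (pr k) (nsqr nY) (nonneg_cst T (ler01 : 0 <= 1 :> R)) (lr k lY2)
  (fun _ _ _ => erefl).
under eq_fun do rewrite mulr1.
by move=> ->; under eq_fun do rewrite mulr1.
Qed.

Let nmY K : nonneg (fun w => Y w * m K w).
Proof. exact: nonnegM. Qed.

Let mY_fin K : (mean P (fun w => (Y w * m K w)%R) < +oo)%E.
Proof.
apply: (@le_lt_trans _ _ (mean P (fun w => Y w ^+ 2 + m K w ^+ 2)%R)).
  apply: le_mean => //; first by apply: nonnegD; exact: nsqr.
  by move=> w _; have := sqr_ge0 (Y w - m K w); nra.
by rewrite meanD//; [exact: lte_add_pinfty|exact: nsqr|exact: nsqr].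
Qed.

(** Pointwise, [m_{K+1}^2 - m_K^2 <= 2 y_K (m_{K+1} - m_K)]: both sides vanish unless [y_K] is the
    new maximum. Both maxima are constant on the classes of [r K], so under the mean [y_K] may be
    replaced by [Y], and the induction telescopes. *)
Let m_step K :
  (mean P (fun w => (m K w ^+ 2)%R) <= 2%:E * mean P (fun w => (Y w * m K w)%R))%E.
Proof.
elim: K => [|K ih].
  have -> : (fun w => (m 0 w ^+ 2)%R) = fun=> 0 by apply/funext => w; rewrite /m expr0n.
  by rewrite mean_cst; apply: mule_ge0; [rewrite lee_fin|exact: mean_ge0].
have nc : nonneg (fun _ : T => 2 : R) by exact: nonneg_cst.
have h : (mean P (fun w => m K.+1 w ^+ 2 + 2 * (y K w * m K w))%R <=
          mean P (fun w => 2 * (y K w * m K.+1 w) + m K w ^+ 2)%R)%E.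
  apply: le_mean => //.
  - by apply: nonnegD; [exact: nsqr|apply: nonnegM => //; exact: nonnegM].
  - by apply: nonnegD; [apply: nonnegM => //; exact: nonnegM|exact: nsqr].
  move=> w _; rewrite /m /= -/(m K w).
  have [_ /(_ w) a] := nm K; have [_ /(_ w) b] := ny K.
  case: (leP (m K w) (y K w)) => hm; last by lra.
  by have := sqr_ge0 (m K w - y K w); nra.
have nyK := nonnegM (ny K) (nm K); have nyK1 := nonnegM (ny K) (nm K.+1).
have n1 := nsqr (nm K); have n2 := nsqr (nm K.+1).
move: h; rewrite (meanD P cT n2 (nonnegM nc nyK)) (meanD P cT (nonnegM nc nyK1) n1).
rewrite (meanZ P cT nyK)// (meanZ P cT nyK1)//.
rewrite !mean_my//.
have := m_fin K; have := m_fin K.+1; have := mY_fin K; have := mY_fin K.+1.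
have := mean_ge0 P (nsqr (nm K)); have := mean_ge0 P (nsqr (nm K.+1)).
have := mean_ge0 P (nmY K); have := mean_ge0 P (nmY K.+1); move: ih.
move: (mean _ _) (mean _ _) (mean _ _) (mean _ _).
move=> [a| |] // [b| |] // [c| |] // [e| |] //.
rewrite -!EFinM -!EFinD !lee_fin; lra.
Qed.

(** Combines [m_step] with [4 Y m <= m^2 + 4 Y^2] and cancels one mean of [m^2]. *)
Lemma doob_L2 K : (mean P (fun w => (runmax (fun k => rce P (r k) Y w) K ^+ 2)%R) <=
  4%:E * mean P (fun w => (Y w ^+ 2)%R))%E.
Proof.
rewrite -[X in (X <= _)%E]/(mean P (fun w => (m K w ^+ 2)%R)).
have n4 : nonneg (fun _ : T => 4 : R) by exact: nonneg_cst.
have h : (mean P (fun w => 4 * (Y w * m K w))%R <=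
  mean P (fun w => m K w ^+ 2 + 4 * Y w ^+ 2)%R)%E.
  apply: le_mean => //; first exact: nonnegM.
    by apply: nonnegD; [exact: nsqr|apply: nonnegM => //; exact: nsqr].
  by move=> w _; have := sqr_ge0 (m K w - 2 * Y w); nra.
have n1 := nsqr (nm K); have n2 := nsqr nY.
move: h; rewrite (meanZ P cT (nmY K))// (meanD P cT n1 (nonnegM n4 n2)).
rewrite (meanZ P cT n2)//.
have := m_fin K; have := mY_fin K; have := fY; have := m_step K.
have := mean_ge0 P (nsqr (nm K)); have := mean_ge0 P (nsqr nY).
have := mean_ge0 P (nmY K).
move: (mean _ _) (mean _ _) (mean _ _) => [a| |] // [b| |] // [c| |] //.
rewrite -!EFinM -!EFinD !lee_fin; lra.
Qed.

End doob.

(** * The lexicographic order on the grid *)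

Section lexicographic_order.

(** The cells of the grid are numbered by [k < N * N] row by row; the successors make both
    coordinates start at 1. *)
Definition lexi N k := (k %/ N).+1.
Definition lexj N k := (k %% N).+1.

Lemma lexi_le N k : (k < N * N)%N -> (lexi N k <= N)%N.
Proof. by case: N => // N h; rewrite /lexi ltn_divLR. Qed.

Lemma lexj_le N k : (0 < N)%N -> (lexj N k <= N)%N.
Proof. by move=> h; rewrite /lexj ltn_mod. Qed.

Lemma lexi_homo N l k : (l <= k)%N -> (lexi N l <= lexi N k)%N.
Proof. by move=> h; rewrite ltnS leq_div2r. Qed.

Lemma lexj_lt N l k : (l < k)%N -> lexi N l = lexi N k ->
  (lexj N l < lexj N k)%N.
Proof.
move=> lk [e]; have := divn_eq l N; have := divn_eq k N.
by rewrite /lexj -e; lia.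
Qed.

Lemma sum_lex (V : nmodType) N (f : nat -> nat -> V) :
  \sum_(k < N * N) f (lexi N k) (lexj N k) =
  \sum_(1 <= i < N.+1) \sum_(1 <= j < N.+1) f i j.
Proof.
rewrite -(big_mkord xpredT (fun k => f (lexi N k) (lexj N k))) big_nat_mul.
rewrite big_add1; apply: eq_big_nat => i /andP[_ iN].
rewrite big_add1 -{1}[(i * N)%N]add0n big_addn mulSn addnK.
apply: eq_big_nat => j /andP[_ jN].
have N0 : (0 < N)%N by case: (N) jN.
by rewrite /lexi /lexj addnC divnMDl// divn_small// addn0 modnMDl modn_small.
Qed.

End lexicographic_order.

(** * Maximal inequality for averages over the F^-_{i,j} *)

Section maximal_inequality.
Context (R : realType) d (T : measurableType d) (P : probability T R).
Hypothesis cT : countable [set: T].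
Variable F : nat -> nat -> set (set T).
Hypothesis hF : biparameter_filtration F.
Hypothesis F4 : F4_condition P F.

Local Notation rF := (rF F).
Local Notation rm := (rm F).
Local Notation rG := (rG F).

(** An earlier cell lies either in the same row and an earlier column, or in an earlier row: the two
    generators F_{i,j-1} and F_{i-1,N} of the past cover these cases. *)
Lemma rG_lex_rF N l k w : (0 < N)%N -> (l < k)%N ->
  rG N (lexi N k) (lexj N k) w `<=` rF (lexi N l) (lexj N l) w.
Proof.
move=> N0 lk v [a b]; have := lexi_homo N (ltnW lk).
rewrite leq_eqVlt => /orP[/eqP e|h].
  by move: b; apply: rF_sub => //; [rewrite e|rewrite -ltnS lexj_lt].
by move: a; apply: rF_sub => //; exact: lexj_le.
Qed.

Lemma rG_lex_homo N l k w : (0 < N)%N -> (l <= k)%N ->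
  rG N (lexi N k) (lexj N k) w `<=` rG N (lexi N l) (lexj N l) w.
Proof.
move=> N0 lk v; rewrite leq_eqVlt in lk; move: lk => /orP[/eqP -> //|lk] h.
split; last by move: (rG_lex_rF N0 lk h); apply: rF_sub.
by move: h => [a _]; move: a; apply: rF_sub => //=; rewrite -ltnS; apply: lexi_homo; exact: ltnW.
Qed.

Lemma runmax_le (y : nat -> R) (c : R) K : 0 <= c ->
  (forall k, (k < K)%N -> y k <= c) -> runmax y K <= c.
Proof.
move=> c0; elim: K => //= K ih h; rewrite ge_max h// ih// => k kK.
by apply: h; exact: ltnW.
Qed.

(** By [rce_rm_rF] and (F4), the average over F^-_{i,j} is the successive average over the past,
    F_{N,j} and F_{i,N}. Each of these families is increasing in a single index, so each maximum
    costs a factor 4 in L^2; 64 = 4^3. *)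
Lemma maximal_rm (Y : T -> R) N : nonneg Y ->
  (mean P (fun w => (Y w ^+ 2)%R) < +oo)%E ->
  (mean P (fun w => (runmax (fun k => rce P (rm (lexi N k) (lexj N k)) Y w)
                            (N * N) ^+ 2)%R) <=
   64%:E * mean P (fun w => (Y w ^+ 2)%R))%E.
Proof.
move=> nY fY; have lY := lintT_of_sqr cT nY fY.
have [->|N0] := posnP N.
  rewrite muln0 /=; have -> : (fun _ : T => 0 ^+ 2 : R) = fun=> 0.
    by apply/funext => w; rewrite expr0n.
  rewrite mean_cst; apply: mule_ge0; first by rewrite lee_fin.
  by apply/mean_ge0/nonneg_sqr; case: nY.
have pF i j := rF_partition cT hF i j.
have pG i j := rG_partition cT hF N i j.
have pm i j := rm_partition cT hF i j.
have rce_adapt r X : measurable_partition r -> adapted point_atom (rce P r X).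
  by move=> pr; exact: adapted_point_atom pr (rce_adapted P X (proj1 pr)).
pose M1 w := runmax (fun k => rce P (rG N (lexi N k) (lexj N k)) Y w) (N * N).
have nM1 : nonneg M1 by apply: nonneg_runmax => k _; exact: rce_adapt.
have h1 : (mean P (fun w => (M1 w ^+ 2)%R) <=
           4%:E * mean P (fun w => (Y w ^+ 2)%R))%E.
  by apply: doob_L2 => // k l w kl; exact: rG_lex_homo.
have f1 : (mean P (fun w => (M1 w ^+ 2)%R) < +oo)%E.
  by apply: le_lt_trans h1 _; rewrite lte_mul_pinfty.
have l1 := lintT_of_sqr cT nM1 f1.
pose M2 w := runmax (fun j => rce P (rF N j.+1) M1 w) N.
have nM2 : nonneg M2 by apply: nonneg_runmax => k _; exact: rce_adapt.
have h2 : (mean P (fun w => (M2 w ^+ 2)%R) <=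
           4%:E * mean P (fun w => (M1 w ^+ 2)%R))%E.
  by apply: doob_L2 => // k l w kl; exact: rF_sub.
have f2 : (mean P (fun w => (M2 w ^+ 2)%R) < +oo)%E.
  by apply: le_lt_trans h2 _; rewrite lte_mul_pinfty.
have l2 := lintT_of_sqr cT nM2 f2.
pose M3 w := runmax (fun i => rce P (rF i.+1 N) M2 w) N.
have nM3 : nonneg M3 by apply: nonneg_runmax => k _; exact: rce_adapt.
have h3 : (mean P (fun w => (M3 w ^+ 2)%R) <=
           4%:E * mean P (fun w => (M2 w ^+ 2)%R))%E.
  by apply: doob_L2 => // k l w kl; exact: rF_sub.
have le4 (a b : \bar R) : (a <= b)%E -> (4%:E * a <= 4%:E * b)%E.
  by move=> ab; apply: lee_wpmul2l => //; rewrite lee_fin.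
apply: (@le_trans _ _ (mean P (fun w => (M3 w ^+ 2)%R))); last first.
  apply: le_trans h3 _; apply: le_trans (le4 _ _ h2) _.
  apply: le_trans (le4 _ _ (le4 _ _ h1)) _.
  rewrite !muleA -!EFinM le_eqVlt; apply/orP; left; apply/eqP.
  by congr (_%:E * _)%E; ring.
have nm : nonneg (fun w => runmax (fun k => rce P (rm (lexi N k) (lexj N k)) Y w)
    (N * N)) by apply: nonneg_runmax => k _; exact: rce_adapt.
apply: le_mean => //.
- by apply: nonneg_sqr; case: nm.
- by apply: nonneg_sqr; case: nM3.
move=> w pw; rewrite ler_pXn2r ?nnegrE//; [|by case: nm|by case: nM3].
apply: runmax_le; first by case: nM3.
move=> k kN; set i := lexi N k; set j := lexj N k.
have iN : (i <= N)%N by exact: lexi_le.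
have jN : (j <= N)%N by exact: lexj_le.
have subT (r : T -> set T) v : r v `<=` [set: T] by [].
have lT r X : measurable_partition r -> lint P (fun=> setT) X ->
    lint P (fun=> setT) (rce P r X).
  by move=> pr lX; apply: lint_rce => //; exact: setT_partition.
rewrite (rce_rm_rF cT hF F4 (N := N)) //; last by case: nY.
apply: (@le_trans _ _ (rce P (rF i j) M1 w)).
  apply: le_rce => //; [exact/(lintT_rF cT hF)/lT|exact: lintT_rF|].
  move=> v _ _; exact: (@le_runmax _ (fun k => rce P (rG N (lexi N k) (lexj N k)) Y v)).
apply: (@le_trans _ _ (rce P (rF i N) (rce P (rF N j) M1) w)).
  by rewrite rce_F4// (minn_idPr iN) (minn_idPl jN).
apply: (@le_trans _ _ (rce P (rF i N) M2 w)).
  apply: le_rce => //; [exact/(lintT_rF cT hF)/lT|exact: lintT_rF|].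
  by move=> v _ _; apply: (@le_runmax _ (fun j => rce P (rF N j.+1) M1 v)).
by apply: (@le_runmax _ (fun i => rce P (rF i.+1 N) M2 w)).
Qed.

End maximal_inequality.

(** * From finite grids to double series *)

Section double_series.
Context (R : realType).
Local Open Scope ereal_scope.

Lemma grid_le_series (e : nat -> nat -> \bar R) N : (forall i j, 0 <= e i j) ->
  \sum_(1 <= i < N.+1) \sum_(1 <= j < N.+1) e i j <=
  \sum_(1 <= i <oo) \sum_(1 <= j <oo) e i j.
Proof.
move=> e0; have s0 i : 0 <= \sum_(1 <= j <oo) e i j by apply: nneseries_ge0.
apply: (@le_trans _ _ (\sum_(1 <= i < N.+1) \sum_(1 <= j <oo) e i j)).
  by apply: lee_sum => i _; exact: nneseries_lim_ge.
exact: nneseries_lim_ge.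
Qed.

(** The iterated limits run over rectangles, and each rectangle is contained in a square of side
    [maxn n m]. *)
Lemma series_le_grid (e : nat -> nat -> \bar R) c : (forall i j, 0 <= e i j) ->
  (forall N, \sum_(1 <= i < N.+1) \sum_(1 <= j < N.+1) e i j <= c) ->
  \sum_(1 <= i <oo) \sum_(1 <= j <oo) e i j <= c.
Proof.
move=> e0 h; have s0 i : 0 <= \sum_(1 <= j <oo) e i j by apply: nneseries_ge0.
apply: lime_le; first exact: is_cvg_nneseries.
apply: nearW => n; rewrite -nneseries_sum_nat//.
apply: lime_le; first by apply: is_cvg_nneseries => j _ _; apply: sume_ge0.
apply: nearW => m; apply: le_trans (h (maxn n m)).
rewrite exchange_big /=.
apply: (@le_trans _ _ (\sum_(1 <= i < n) \sum_(1 <= j < (maxn n m).+1) e i j)).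
  apply: lee_sum => i _; apply: lee_sum_nneg_natr => // .
  by rewrite ltnW// ltnS leq_maxr.
apply: lee_sum_nneg_natr => // [i _ _|]; first by apply: sume_ge0.
by rewrite ltnW// ltnS leq_maxl.
Qed.

End double_series.

Section square_root_of_series.
Context (R : realType) d (T : measurableType d) (P : probability T R).
Hypothesis cT : countable [set: T].

Lemma sum_grid_homo (u : nat -> nat -> R) N M : (forall i j, 0 <= u i j) ->
  (N <= M)%N -> \sum_(1 <= i < N.+1) \sum_(1 <= j < N.+1) u i j <=
  \sum_(1 <= i < M.+1) \sum_(1 <= j < M.+1) u i j.
Proof.
move=> u0 NM.
rewrite [leRHS](big_cat_nat (n := N.+1))//= -[leLHS]addr0; apply: lerD.
  apply: ler_sum => i _; rewrite [leRHS](big_cat_nat (n := N.+1))//=.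
  by rewrite lerDl; apply: sumr_ge0.
by apply: sumr_ge0 => i _; apply: sumr_ge0.
Qed.

(** Monotone convergence along the square grids; the limit of the finite roots dominates the root of
    the series. *)
Lemma integral_sqrte_series_le (u : nat -> nat -> T -> R) (c : \bar R) :
  (forall i j, nonneg (u i j)) ->
  (forall N, mean P (fun w => Num.sqrt
     (\sum_(1 <= i < N.+1) \sum_(1 <= j < N.+1) u i j w))%R <= c)%E ->
  (\int[P]_w sqrte (\sum_(1 <= i <oo) \sum_(1 <= j <oo) (u i j w)%:E) <= c)%E.
Proof.
move=> nu h; have u0 i j w : 0 <= u i j w by case: (nu i j).
pose q N w := Num.sqrt (\sum_(1 <= i < N.+1) \sum_(1 <= j < N.+1) u i j w).
have nq N : nonneg (q N).
  split=> [|w]; last exact: sqrtr_ge0.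
  apply: (adapted_comp Num.sqrt).
  by apply: adapted_sum => i _; apply: adapted_sum => j _; case: (nu i j).
have mq N : measurable_fun setT (EFin \o q N).
  by apply: measurable_fun_adapted => //; apply: adapted_comp; case: (nq N).
have q0 N w : (0 <= (q N w)%:E)%E by rewrite lee_fin sqrtr_ge0.
have qh w : nondecreasing_seq (fun N => (q N w)%:E).
  move=> N M NM; rewrite lee_fin; apply: ler_wsqrtr.
  exact: sum_grid_homo.
have L := cvg_monotone_convergence (mu := P) measurableT mq
  (fun N w _ => q0 N w) (fun w _ => qh w).
apply: (@le_trans _ _ (\int[P]_w limn (fun N => (q N w)%:E))%E); last first.
  rewrite -(cvg_lim _ L)//; apply: lime_le; first by apply/cvg_ex; eexists; exact: L.
  by apply: nearW => N; exact: h.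
have lq w N : ((q N w)%:E <= limn (fun N => (q N w)%:E))%E.
  apply: lime_ge; first exact: ereal_nondecreasing_is_cvgn.
  by near=> M; apply: qh; near: M; exists N.
apply: ge0_le_integral => //.
- by move=> w _; exact: sqrte_ge0.
- apply: measurable_fun_adapted => // w v wv.
  congr sqrte; apply: eq_eseriesr => i _; apply: eq_eseriesr => j _.
  by have [a _] := nu i j; rewrite (a _ _ wv).
- apply: measurable_fun_adapted => // w v wv; congr (limn _).
  by apply/funext => N; have [a _] := nq N; rewrite (a _ _ wv).
move=> w _; have l0 : (0 <= limn (fun N => (q N w)%:E))%E.
  exact: le_trans (q0 0%N w) (lq w 0%N).
rewrite -[leRHS]gee0_abs// -sqrte_sqr lee_sqrt; last by rewrite sqre_ge0.
apply: series_le_grid => [i j|N]; first by rewrite lee_fin.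
have := lq w N; move: (limn _) l0 => [l| |] // l0.
  rewrite /= lee_fin => ql.
  under eq_bigr do rewrite sumEFin.
  rewrite sumEFin lee_fin -(@sqr_sqrtr _ (\sum_(1 <= i < N.+1) _)).
    by rewrite ler_pXn2r// nnegrE// sqrtr_ge0.
  by apply: sumr_ge0 => i _; apply: sumr_ge0.
by move=> _; rewrite expe2 mulyy leey.
Unshelve. all: by end_near. Qed.

(** Here the weights [D] may vanish. They are shifted by a positive constant, which is then sent to
    0. *)
Lemma mean_sqrt_sum_le_limit (a b D : nat -> T -> R) (M : T -> R) K :
  (forall k, nonneg (a k)) -> (forall k, nonneg (b k)) ->
  (forall k, nonneg (D k)) -> nonneg M ->
  (forall k w, (k < K)%N -> D k w <= M w) ->
  (forall k w, (k < K)%N -> \sum_(l < k.+1) a l w <= D k w) ->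
  (forall k e, (k < K)%N -> 0 < e ->
    (mean P (fun w => b k w * (Num.sqrt (e + D k w))^-1)%R <=
     mean P (fun w => a k w * (Num.sqrt (e + D k w))^-1)%R)%E) ->
  (mean P (fun w => Num.sqrt (\sum_(k < K) b k w))%R <=
   (3 / 2)%:E * mean P (fun w => Num.sqrt (M w))%R)%E.
Proof.
move=> na nb nD nM DM aD hab; apply/lee_addgt0Pr => e e0.
(* Chosen so that [(3 / 2) * sqrt e' = e], the error finally allowed. *)
pose e' := (2 / 3 * e) ^+ 2.
have e'0 : 0 < e' by rewrite exprn_gt0// mulr_gt0.
have nc : nonneg (fun _ : T => e') by apply: nonneg_cst; exact: ltW.
have nsM (c : R) : nonneg (fun w => Num.sqrt (c + M w)).
  split=> [|w]; last exact: sqrtr_ge0.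
  by case: nM => aM _; exact: (adapted_comp (fun x => Num.sqrt (c + x))).
have nsM0 : nonneg (fun w => Num.sqrt (M w)).
  split=> [|w]; last exact: sqrtr_ge0.
  by case: nM => aM _; exact: (adapted_comp (fun x => Num.sqrt x)).
apply: (@le_trans _ _ ((3 / 2)%:E * mean P (fun w => Num.sqrt (e' + M w))%R)%E).
  apply: (mean_sqrt_sum_le cT (a := a) (D := fun k w => e' + D k w)) => //.
  - by move=> k; exact: nonnegD.
  - exact: nonnegD.
  - by move=> k w; apply: ltr_wpDr => //; case: (nD k).
  - by move=> w; apply: ltr_wpDr => //; case: nM.
  - by move=> k w kK; rewrite lerD2l DM.
  - by move=> k w kK; rewrite (le_trans (aD k w kK))// lerDr ltW.
  - by move=> k kK; exact: hab.
apply: (@le_trans _ _ ((3 / 2)%:E *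
    mean P (fun w => Num.sqrt (M w) + 2 / 3 * e)%R)%E).
  apply: lee_wpmul2l; first by rewrite lee_fin.
  apply: le_mean => //.
    by apply: nonnegD => //; apply: nonneg_cst; rewrite mulr_ge0// ltW.
  move=> w _; have M0 : 0 <= M w by case: nM.
  have h0 : 0 <= 2 / 3 * e by rewrite mulr_ge0// ltW.
  have h1 : 0 <= Num.sqrt (M w) := sqrtr_ge0 _.
  rewrite -[leRHS]ger0_norm ?addr_ge0// -sqrtr_sqr; apply: ler_wsqrtr.
  have := sqr_sqrtr M0; rewrite /e'; nra.
rewrite (meanD P cT nsM0); last by apply: nonneg_cst; rewrite mulr_ge0// ltW.
rewrite mean_cst ge0_muleDr//; last 2 first.
- exact: mean_ge0.
- by rewrite lee_fin mulr_ge0// ltW.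
by rewrite -EFinM (_ : 3 / 2 * (2 / 3 * e) = e); last by field.
Qed.

End square_root_of_series.

(** * Martingales and their differences *)

Section martingales.
Context (R : realType) d (T : measurableType d) (P : probability T R).
Hypothesis cT : countable [set: T].
Variable F : nat -> nat -> set (set T).
Hypothesis hF : biparameter_filtration F.

Local Notation rF := (rF F).
Local Notation rm := (rm F).
Local Notation rG := (rG F).
Implicit Types f g h : nat -> nat -> T -> R.

Lemma rF_atom i j : (1 <= i)%N -> (1 <= j)%N -> rF i j = atom (F i j).
Proof.
by rewrite !lt0n /rF /filtration0 => /negbTE -> /negbTE ->.
Qed.

Lemma Fminus_sigma_algebra i j : sigma_algebra [set: T] (Fminus F i j).
Proof. exact: smallest_sigma_algebra. Qed.

Lemma Fminus_measurable i j : Fminus F i j `<=` measurable.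
Proof.
apply: smallest_sub; first exact: sigma_algebra_measurable.
have h a b : filtration0 F a b `<=` measurable.
  rewrite /filtration0; case: ifPn => [_ A [->|->] //|].
  rewrite negb_or -!lt0n => /andP[a0 b0]; exact: (bf_sub_measurable hF).
by move=> A [/h|/h].
Qed.

Lemma martingale_adapted f i j : martingale P F f -> (1 <= i)%N -> (1 <= j)%N ->
  adapted (rF i j) (f i j).
Proof.
move=> [_ h] i1 j1; have [m _] := h i j i j i1 j1 (leqnn _) (leqnn _).
rewrite rF_atom// => w v wv; have := adapted_atom m wv.
by move=> -[].
Qed.

Lemma martingale_lint f i j : martingale P F f -> (1 <= i)%N -> (1 <= j)%N ->
  lint P (fun=> setT) (f i j).
Proof.
move=> mf i1 j1; split=> [|_]; last by case: mf => h _; exact: h.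
apply: adapted_point_atom (rF_partition cT hF i j) _.
exact: martingale_adapted.
Qed.

(** Extension by 0 to the axes, which turns the four cases of [mdiff] into one rectangular
    increment. *)
Let f0 f i j w : R := if (i == 0)%N || (j == 0)%N then 0 else f i j w.

Let mdiffE f i j w : (1 <= i)%N -> (1 <= j)%N ->
  mdiff f i j w = f0 f i j w - f0 f i.-1 j w - f0 f i j.-1 w + f0 f i.-1 j.-1 w.
Proof.
case: i => // i; case: j => // j _ _.
by case: i => [|i]; case: j => [|j] /=; rewrite /f0 /= ?subr0 ?addr0.
Qed.

Let mdiff0 f i j w : (i == 0)%N || (j == 0)%N -> mdiff f i j w = 0.
Proof. by case: i => [|[|i]]; case: j => [|[|j]]. Qed.

Lemma mdiff_adapted f i j : martingale P F f -> adapted (rF i j) (mdiff f i j).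
Proof.
move=> mf w v wv; have [h|] := boolP ((i == 0)%N || (j == 0)%N).
  by rewrite !mdiff0.
rewrite negb_or -!lt0n => /andP[i0 j0]; rewrite !mdiffE//.
suff E a b : (a <= i)%N -> (b <= j)%N -> f0 f a b v = f0 f a b w.
  by rewrite (E i j)// (E i.-1 j) ?leq_pred// (E i j.-1) ?leq_pred// (E i.-1 j.-1) ?leq_pred.
rewrite /f0 => ai bj; case: ifPn => //; rewrite negb_or -!lt0n => /andP[a0 b0].
by apply: martingale_adapted => //; apply: rF_sub wv.
Qed.

Lemma mdiff_lint f i j : martingale P F f -> lint P (fun=> setT) (mdiff f i j).
Proof.
have pT := @setT_partition _ T.
move=> mf; have [h|] := boolP ((i == 0)%N || (j == 0)%N).
  rewrite (_ : mdiff f i j = fun=> 0); first exact: lint_cst.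
  by apply/funext => w; rewrite mdiff0.
rewrite negb_or -!lt0n => /andP[i0 j0].
have E a b : lint P (fun=> setT) (f0 f a b).
  rewrite /f0; have [|z] := boolP ((a == 0)%N || (b == 0)%N).
    by move=> _; exact: lint_cst.
  by move: z; rewrite negb_or -!lt0n => /andP[a0 b0]; exact: martingale_lint.
rewrite (_ : mdiff f i j = fun w =>
    f0 f i j w - f0 f i.-1 j w - f0 f i j.-1 w + f0 f i.-1 j.-1 w).
  by apply: lintD => //; apply: lintB => //; apply: lintB.
by apply/funext => w; rewrite mdiffE.
Qed.

Lemma martingaleB f h : martingale P F f -> martingale P F h ->
  martingale P F (fun i j w => f i j w - h i j w).
Proof.
move=> [if_ mf] [ih mh]; split=> [i j i1 j1|i j i' j' i1 j1 ii jj].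
  exact: (integrableB measurableT (if_ _ _ i1 j1) (ih _ _ i1 j1)).
have i'1 := leq_trans i1 ii; have j'1 := leq_trans j1 jj.
split.
  apply: measurable_fun_atom => //; rewrite -rF_atom//.
  apply: (adapted_comp EFin); apply: (adapted_comp2 (fun x y => x - y));
    exact: martingale_adapted.
move=> A FA; have mA := bf_sub_measurable hF i1 j1 FA.
have iS X : P.-integrable setT X -> P.-integrable A X.
  by apply: integrableS.
rewrite integralB_EFin//; [|exact/iS/if_|exact/iS/ih].
rewrite integralB_EFin//; [|exact/iS/if_|exact/iS/ih].
have [_ -> //] := mf _ _ _ _ i1 j1 ii jj.
by have [_ -> //] := mh _ _ _ _ i1 j1 ii jj.
Qed.

Lemma mdiffB f h i j w : mdiff (fun i j w => f i j w - h i j w) i j w =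
  mdiff f i j w - mdiff h i j w.
Proof. by case: i => [|[|i]]; case: j => [|[|j]] //=; ring. Qed.

(** Double partial sums vanish on the axes, so the rectangular increment inverts them up to the
    border. *)
Lemma mdiff_sum (D : nat -> nat -> T -> R) i j w : (1 <= i)%N -> (1 <= j)%N ->
  mdiff (fun i j w => \sum_(1 <= k < i.+1) \sum_(1 <= l < j.+1) D k l w) i j w =
  D i j w.
Proof.
move=> i1 j1; rewrite mdiffE//; set h := (fun i j w => _).
have h0E a b : f0 h a b w = h a b w.
  rewrite /f0; case: ifPn => // /orP[|] /eqP ->; rewrite /h.
    by rewrite big_geq.
  by rewrite big1// => k _; rewrite big_geq.
rewrite !h0E; case: i j i1 j1 => [|i] [|j] // _ _; rewrite /h /=.
rewrite ![\sum_(1 <= k < i.+2) _]big_nat_recr//= ![\sum_(1 <= l < j.+2) _]big_nat_recr//=.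
ring.
Qed.

Lemma cond_exp_Fminus i j (X : T -> \bar R) w : adapted point_atom X ->
  (forall w, 0 <= X w)%E -> pos P w ->
  cond_exp P (Fminus F i j) X w = cev P (rm i j) X w.
Proof.
move=> aX X0 pw; rewrite cond_expE ?atom_Fminus//.
- exact: Fminus_sigma_algebra.
- exact: Fminus_measurable.
- by left.
Qed.

Lemma cond_exp_Fminus_adapted i j (X : T -> \bar R) : adapted point_atom X ->
  (forall w, 0 <= X w)%E ->
  adapted point_atom (cond_exp P (Fminus F i j) X).
Proof.
move=> aX X0; apply: (adapted_point_atom (rm_partition cT hF i j)).
rewrite -atom_Fminus; apply: cond_exp_adapted => //.
- exact: Fminus_sigma_algebra.
- exact: Fminus_measurable.
- by left.
Qed.

Lemma cond_square_function_adapted f : martingale P F f ->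
  adapted point_atom (cond_square_function P F f).
Proof.
move=> mf w v wv; rewrite /cond_square_function.
congr sqrte; apply: eq_eseriesr => i _; apply: eq_eseriesr => j _.
apply: cond_exp_Fminus_adapted wv => [|u].
  apply: (adapted_comp (fun x : R => (`|x| ^+ 2)%:E)).
  by case: (mdiff_lint i j mf).
by rewrite lee_fin sqr_ge0.
Qed.

End martingales.

(** * Bounding the square function by the conditional one *)

Section square_function_bound.
Context (R : realType) d (T : measurableType d) (P : probability T R).
Hypothesis cT : countable [set: T].
Variable F : nat -> nat -> set (set T).
Hypothesis hF : biparameter_filtration F.
Hypothesis F4 : F4_condition P F.

Local Notation rF := (rF F).
Local Notation rm := (rm F).
Local Notation rG := (rG F).
Implicit Types f g h : nat -> nat -> T -> R.

Lemma sqrt_grid_lex (u : nat -> nat -> T -> R) N :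
  (fun w => Num.sqrt (\sum_(1 <= i < N.+1) \sum_(1 <= j < N.+1) u i j w)) =
  (fun w => Num.sqrt (\sum_(k < N * N) u (lexi N k) (lexj N k) w)).
Proof.
by apply/funext => w; rewrite (sum_lex N (fun i j => u i j w)).
Qed.

(* The lexicographic order turns the comparison of the two square functions into
   a one-parameter statement, since [rce (rG N i j)] and [rce (rm i j)] agree on
   functions adapted to [rF i j]. *)
Lemma mean_sqrt_rce_le (x : nat -> nat -> T -> R) N :
  (forall i j, nonneg (x i j)) -> (forall i j, adapted (rF i j) (x i j)) ->
  (forall i j, lint P (rm i j) (x i j)) ->
  (mean P (fun w => Num.sqrt
     (\sum_(1 <= i < N.+1) \sum_(1 <= j < N.+1) x i j w))%R <=
   (3 / 2)%:E * mean P (fun w => Num.sqrt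
     (\sum_(1 <= i < N.+1) \sum_(1 <= j < N.+1) rce P (rm i j) (x i j) w))%R)%E.
Proof.
move=> nx ax lx; rewrite !sqrt_grid_lex.
have [->|N0] := posnP N.
  under eq_fun do rewrite muln0 big_ord0 sqrtr0.
  under [X in (_ <= _ * mean _ X)%E]eq_fun do rewrite muln0 big_ord0 sqrtr0.
  by rewrite mean_cst mule0.
pose X k := x (lexi N k) (lexj N k).
have nX k : nonneg (X k) by exact: nx.
pose A k := rce P (rm (lexi N k) (lexj N k)) (X k).
have pm i j := rm_partition cT hF i j.
have pG i j := rG_partition cT hF N i j.
have aA k : adapted (rm (lexi N k) (lexj N k)) (A k).
  exact: (rce_adapted P _ (proj1 (pm _ _))).
have nA k : nonneg (A k).
  split; first exact: adapted_point_atom (pm _ _) (aA k).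
  by move=> w; apply: rce_ge0; case: (nx (lexi N k) (lexj N k)).
have nS K : nonneg (fun w => \sum_(l < K) A l w).
  exact: (nonneg_sum _ (fun l : 'I_K => nA l)).
apply: (mean_sqrt_sum_le_limit cT (a := A) (b := X)
  (D := fun k w => \sum_(l < k.+1) A l w)) => //.
- move=> k w kK; rewrite -!(big_mkord xpredT (A^~ w)).
  rewrite [leRHS](big_cat_nat (n := k.+1))//= lerDl.
  by apply: sumr_ge0 => l _; case: (nA l).
- move=> k e kN e0; rewrite le_eqVlt; apply/orP; left; apply/eqP; symmetry.
  apply: (integral_rce_rm cT hF F4 (N := N)) => //.
  + exact: lexj_le.
  + by case: (nx (lexi N k) (lexj N k)).
  + apply: (adapted_comp (fun y => (Num.sqrt (e + y))^-1)).
    apply: adapted_sum => l _.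
    apply: adaptedS (aA l) => w v wv.
    apply: (rG_rm hF (lexj_le (nat_of_ord l) N0)).
    apply: (rG_lex_homo hF N0 _ wv).
    by rewrite -ltnS.
Qed.

(** The differences of [g] are only known to be integrable. If [H1sigma_norm P F g] is finite, then
    sigma(g) is finite at positive points, and this yields integrability of the squares on each
    class of [rm], as [mean_sqrt_rce_le] demands; otherwise the bound is trivial. *)
Lemma mean_square_function_le g N : martingale P F g ->
  (mean P (fun w => Num.sqrt (\sum_(1 <= i < N.+1) \sum_(1 <= j < N.+1)
     `|mdiff g i j w| ^+ 2))%R <= (3 / 2)%:E * H1sigma_norm P F g)%E.
Proof.
move=> mg; pose x i j w := `|mdiff g i j w| ^+ 2.
have [->|fH] := eqVneq (H1sigma_norm P F g) +oo%E.
  by rewrite mulry gtr0_sg ?mul1e ?leey// divr_gt0.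
have nx i j : nonneg (x i j).
  split=> [|w]; last exact: sqr_ge0.
  by case: (mdiff_lint cT hF i j mg) => a _; exact: (adapted_comp (fun x => `|x| ^+ 2)).
have ax i j : adapted (rF i j) (x i j).
  have amd : adapted (rF i j) (mdiff g i j) by apply: mdiff_adapted mg.
  by move=> w v wv; rewrite /x (amd _ _ wv).
have aX i j : adapted point_atom (EFin \o x i j).
  by apply: adapted_comp; case: (nx i j).
have X0 i j w : (0 <= (EFin \o x i j) w)%E by rewrite /= lee_fin; case: (nx i j).
have pm i j := rm_partition cT hF i j.
have ge0_ce i j w : pos P w -> (0 <= cond_exp P (Fminus F i j) (EFin \o x i j) w)%E.
  move=> pw; rewrite cond_exp_Fminus//; apply: mule_ge0; first exact: integral_ge0.
  by rewrite lee_fin invr_ge0 fine_ge0.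
have acs := cond_square_function_adapted cT hF mg.
have cs0 w : (0 <= cond_square_function P F g w)%E by exact: sqrte_ge0.
have ics : P.-integrable setT (cond_square_function P F g).
  apply/integrableP; split; first exact: measurable_fun_adapted.
  under eq_integral do rewrite gee0_abs//.
  by rewrite ltey.
have fin_ce i j w : (1 <= i)%N -> (1 <= j)%N -> pos P w ->
    (cond_exp P (Fminus F i j) (EFin \o x i j) w < +oo)%E.
  move=> i1 j1 pw.
  have := pos_ae cT (integrable_ae measurableT ics) pw => /(_ I).
  rewrite /cond_square_function sqrte_fin_num; last first.
    by apply: nneseries_ge0 => a _ _; apply: nneseries_ge0 => b _ _; exact: ge0_ce.
  have g0 a b := ge0_ce a b w pw.
  rewrite ge0_fin_numE; last first.
    by apply: nneseries_ge0 => a _ _; apply: nneseries_ge0.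
  apply: le_lt_trans.
  pose e a b := cond_exp P (Fminus F a b) (EFin \o x a b) w.
  (* A square of side [maxn i j] contains the cell [(i, j)]; all other terms are then dropped. *)
  apply: le_trans (grid_le_series (maxn i j) (e := e) g0).
  rewrite (big_cat_nat (n := i))/=; [|by []|by rewrite ltnW// ltnS leq_maxl].
  rewrite (big_ltn (m := i)) ?ltnS ?leq_maxl//.
  have e0 a b : (0 <= e a b)%E by exact: g0.
  have r0 (r t : seq nat) : (0 <= \sum_(a <- r) \sum_(b <- t) e a b)%E.
    by apply: sume_ge0 => a _; apply: sume_ge0.
  have s0 (t : seq nat) : (0 <= \sum_(b <- t) e i b)%E by apply: sume_ge0.
  apply: le_trans (leeDr _ (r0 _ _)); apply: le_trans (leeDl _ (r0 _ _)).
  rewrite (big_cat_nat (n := j))/=; [|by []|by rewrite ltnW// ltnS leq_maxr].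
  rewrite (big_ltn (m := j)) ?ltnS ?leq_maxr//.
  by apply: le_trans (leeDr _ (s0 _)); apply: leeDl.
have fin_int i j w : (1 <= i)%N -> (1 <= j)%N ->
    P.-integrable (rm i j w) (EFin \o x i j).
  move=> i1 j1; have [_ mm] := pm i j.
  have mX : measurable_fun (rm i j w) (EFin \o x i j).
    exact/measurable_funTS/measurable_fun_adapted.
  have [pw|/negPn/eqP pw] := boolP (P (rm i j w) != 0%E); last first.
    exact: null_set_integrable.
  have [v wv pv] := class_pos cT (pm i j) pw.
  have [[_ hr] _] := pm i j; rewrite -(hr _ _ wv).
  apply/integrableP; split; first exact/measurable_funTS/measurable_fun_adapted.
  have -> : (\int[P]_(u in rm i j v) `|(EFin \o x i j) u| =
            \int[P]_(u in rm i j v) (EFin \o x i j) u)%E.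
    by apply: eq_integral => u _; rewrite gee0_abs.
  have := fin_ce i j v i1 j1 pv; rewrite cond_exp_Fminus// /cev.
  have := pos_class cT (pm i j) pv; move: (fine _) => p p0.
  have : (0 <= \int[P]_(u in rm i j v) (EFin \o x i j) u)%E.
    by apply: integral_ge0 => u _; exact: X0.
  case: (\int[P]_(u in rm i j v) (EFin \o x i j) u)%E => [r| |] //= _.
    by move=> _; rewrite ltry.
  by rewrite mulyr gtr0_sg ?invr_gt0// mul1e.
have lx i j : lint P (rm i j) (x i j).
  have [h|] := boolP ((i == 0)%N || (j == 0)%N).
    rewrite (_ : x i j = fun=> 0); first exact: lint_cst.
    apply/funext => w; rewrite /x (_ : mdiff g i j w = 0) ?normr0 ?expr0n//.
    by case: (i) (j) h => [|[|?]] [|[|?]].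
  rewrite negb_or -!lt0n => /andP[i0 j0].
  by split; [case: (nx i j)|move=> w; exact: fin_int].
apply: (le_trans (mean_sqrt_rce_le N nx ax lx)).
apply: lee_wpmul2l; first by rewrite lee_fin.
have nr i j : nonneg (rce P (rm i j) (x i j)).
  split; first exact: adapted_point_atom (pm i j) (rce_adapted P _ (proj1 (pm i j))).
  by move=> w; apply: rce_ge0; case: (nx i j).
have r0 i j w : 0 <= rce P (rm i j) (x i j) w by case: (nr i j).
apply: le_integral_pos => //.
- apply: (adapted_comp (fun y => (Num.sqrt y)%:E)).
  by apply: adapted_sum => i _; apply: adapted_sum => j _; case: (nr i j).
move=> w pw; have g0 a b := ge0_ce a b w pw.
rewrite -[leLHS]/(sqrte (\sum_(1 <= i < N.+1) \sum_(1 <= j < N.+1)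
  rce P (rm i j) (x i j) w)%:E) /cond_square_function lee_sqrt; last first.
  by apply: nneseries_ge0 => a _ _; apply: nneseries_ge0.
pose e a b := cond_exp P (Fminus F a b) (EFin \o x a b) w.
apply: le_trans (grid_le_series N (e := e) g0).
rewrite -sumEFin; apply: lee_sum => i _; rewrite -sumEFin; apply: lee_sum => j _.
by rewrite /e cond_exp_Fminus// cev_rce.
Qed.

(** The sum of the squares of the [y i j] is at most the square of their sum, and
    [2 X + 2 Y^2 <= (2 (sqrt X + Y))^2]. *)
Lemma sqrt_grid_add_le (x y z : nat -> nat -> R) N :
  (forall i j, 0 <= x i j) -> (forall i j, 0 <= y i j) ->
  (forall i j, 0 <= z i j) ->
  (forall i j, z i j <= 2 * x i j + 2 * y i j ^+ 2) ->
  Num.sqrt (\sum_(1 <= i < N.+1) \sum_(1 <= j < N.+1) z i j) <=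
  2 * (Num.sqrt (\sum_(1 <= i < N.+1) \sum_(1 <= j < N.+1) x i j) +
       \sum_(1 <= i < N.+1) \sum_(1 <= j < N.+1) y i j).
Proof.
move=> x0 y0 z0 h.
rewrite -!(sum_lex N).
have X0 : 0 <= \sum_(k < N * N) x (lexi N k) (lexj N k) by apply: sumr_ge0.
have Y0 : 0 <= \sum_(k < N * N) y (lexi N k) (lexj N k) by apply: sumr_ge0.
have hZ : \sum_(k < N * N) z (lexi N k) (lexj N k) <=
    2 * (\sum_(k < N * N) x (lexi N k) (lexj N k)) +
    2 * (\sum_(k < N * N) y (lexi N k) (lexj N k)) ^+ 2.
  apply: (@le_trans _ _ (\sum_(k < N * N) (2 * x (lexi N k) (lexj N k) +
                                           2 * y (lexi N k) (lexj N k) ^+ 2))).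
    by apply: ler_sum => k _; exact: h.
  rewrite big_split /= -!mulr_sumr lerD2l ler_pM2l//.
  elim: (N * N)%N => [|K ih]; first by rewrite !big_ord0 expr0n.
  rewrite !big_ord_recr /=.
  have : 0 <= \sum_(k < K) y (lexi N k) (lexj N k) by apply: sumr_ge0.
  have := y0 (lexi N K) (lexj N K).
  move: (y _ _) (\sum_(k < K) y _ _) (\sum_(k < K) _) ih => a b c; nra.
set X := \sum_(k < _) x _ _ in X0 hZ *; set Y := \sum_(k < _) y _ _ in Y0 hZ *.
have s0 := sqrtr_ge0 X; have := sqr_sqrtr X0 => sX.
have g0 : 0 <= 2 * (Num.sqrt X + Y) by rewrite mulr_ge0// addr_ge0.
rewrite -[leRHS]ger0_norm// -sqrtr_sqr; apply: ler_wsqrtr.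
apply: le_trans hZ _; rewrite -{1}sX; nra.
Qed.

(** Pointwise, S(f) is at most twice S(g) plus the sum of the [|mdiff h|]. The coefficient of the
    latter is weakened from 1 to 3/2 so that 2 * 3/2 factors out. *)
Lemma H1S_norm_le f g h : martingale P F f -> martingale P F g ->
  martingale P F h ->
  (forall i j w, (1 <= i)%N -> (1 <= j)%N -> f i j w = g i j w + h i j w) ->
  (H1S_norm P f <= 3%:E * (H1sigma_norm P F g + sum_mdiff_norm P h))%E.
Proof.
move=> mf mg mh fgh.
have am k i j : martingale P F k -> adapted point_atom (mdiff k i j).
  by move=> mk; case: (mdiff_lint cT hF i j mk).
have nsq k i j : martingale P F k -> nonneg (fun w => `|mdiff k i j w| ^+ 2).
  move=> mk; split=> [|w]; last exact: sqr_ge0.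
  by apply: (adapted_comp (fun x => `|x| ^+ 2)); exact: am.
have nab i j : nonneg (fun w => `|mdiff h i j w|).
  by split=> // ; apply: (adapted_comp (fun x => `|x|)); exact: am.
have ngrid (u : nat -> nat -> T -> R) N : (forall i j, nonneg (u i j)) ->
    nonneg (fun w => \sum_(1 <= i < N.+1) \sum_(1 <= j < N.+1) u i j w).
  by move=> nu; apply: nonneg_sum => i; apply: nonneg_sum => j.
have nsqrt (X : T -> R) : nonneg X -> nonneg (fun w => Num.sqrt (X w)).
  move=> [aX _]; split=> [|w]; last exact: sqrtr_ge0.
  exact: (adapted_comp (fun x => Num.sqrt x)).
have Hs0 : (0 <= H1sigma_norm P F g)%E by apply: integral_ge0 => w _; exact: sqrte_ge0.
have E0 i j : (0 <= 'E_P[fun w => `|mdiff h i j w|%R])%E.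
  by apply: expectation_ge0.
have Sm0 : (0 <= sum_mdiff_norm P h)%E.
  by apply: nneseries_ge0 => i _ _; apply: nneseries_ge0.
apply: integral_sqrte_series_le => // [i j|N]; first exact: nsq.
apply: (@le_trans _ _ (mean P (fun w => 2 * (Num.sqrt
   (\sum_(1 <= i < N.+1) \sum_(1 <= j < N.+1) `|mdiff g i j w| ^+ 2) +
    \sum_(1 <= i < N.+1) \sum_(1 <= j < N.+1) `|mdiff h i j w|))%R)).
  apply: le_mean => //.
  - by apply: nsqrt; apply: ngrid => i j; exact: nsq.
  - apply: nonnegM; first exact: nonneg_cst.
    by apply: nonnegD; [apply/nsqrt/ngrid => i j; exact: nsq|exact: ngrid].
  move=> w _; apply: sqrt_grid_add_le => // i j; try exact: sqr_ge0.
  have -> : mdiff f i j w = mdiff g i j w + mdiff h i j w.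
    have [/orP z|] := boolP ((i == 0)%N || (j == 0)%N).
      by case: z => /eqP ->; [rewrite /= addr0|case: (i) => [|[|?]]; rewrite /= addr0].
    rewrite negb_or -!lt0n => /andP[]; case: i => // i; case: j => // j _ _.
    by case: i => [|i]; case: j => [|j] /=; rewrite !fgh//; ring.
  rewrite !real_normK ?num_real//.
  by have := sqr_ge0 (mdiff g i j w - mdiff h i j w); nra.
rewrite meanZ//; last first.
  by apply: nonnegD; [apply/nsqrt/ngrid => i j; exact: nsq|exact: ngrid].
rewrite meanD//; [|by apply/nsqrt/ngrid => i j; exact: nsq|exact: ngrid].
have h1 := mean_square_function_le N mg.
have h2 : (mean P (fun w => \sum_(1 <= i < N.+1) \sum_(1 <= j < N.+1)
    `|mdiff h i j w|)%R <= sum_mdiff_norm P h)%E.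
  rewrite mean_sum//; last by move=> i; exact: nonneg_sum.
  under eq_bigr do rewrite mean_sum//.
  apply: le_trans (grid_le_series N E0).
  by apply: lee_sum => i _; apply: lee_sum => j _; rewrite unlock.
apply: (@le_trans _ _ (2%:E * ((3 / 2)%:E * H1sigma_norm P F g +
                        (3 / 2)%:E * sum_mdiff_norm P h))%E).
  apply: lee_wpmul2l; first by rewrite lee_fin.
  apply: leeD => //; apply: le_trans h2 _; rewrite -[leLHS]mul1e.
  by apply: lee_wpmul2r => //; rewrite lee_fin; lra.
rewrite -ge0_muleDr// muleA -EFinM le_eqVlt; apply/orP; left; apply/eqP.
by congr (_%:E * _)%E; field.
Qed.

End square_function_bound.

(** * The decomposition *)

Section martingale_differences.
Context (R : realType) d (T : measurableType d) (P : probability T R).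
Hypothesis cT : countable [set: T].
Variable F : nat -> nat -> set (set T).
Hypothesis hF : biparameter_filtration F.
Hypothesis F4 : F4_condition P F.

Local Notation rF := (rF F).
Local Notation rm := (rm F).
Local Notation lintT := (lint P (fun=> [set: T])).
Implicit Types X : T -> R.

(* With the value 0 (and not the mean) on the axes, [fun X => X - compensator
   i j X] sends adapted functions to martingale differences for all i, j >= 1,
   including i = 1 and j = 1. *)
Definition ce0 i j X : T -> R :=
  if (i == 0)%N || (j == 0)%N then fun=> 0 else rce P (rF i j) X.

(** Inclusion-exclusion: by (F4), [X - compensator i j X] is the product of 1 - E[. | F_{i-1,j}] and
    1 - E[. | F_{i,j-1}] applied to [X], hence killed by both conditional expectations. *)
Definition compensator i j X (w : T) : R :=
  ce0 i.-1 j X w + ce0 i j.-1 X w - ce0 i.-1 j.-1 X w.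

Lemma ce0_lint i j X : lintT X -> lintT (ce0 i j X).
Proof.
move=> lX; rewrite /ce0; case: ifP => _.
  by apply: lint_cst; exact: setT_partition.
by apply: lint_rce => //; exact: rF_partition.
Qed.

Lemma ce0_adapted i j X : adapted (rF i j) (ce0 i j X).
Proof.
rewrite /ce0; case: ifP => _; first by [].
exact: (rce_adapted P X (proj1 (rF_partition cT hF i j))).
Qed.

Lemma rce_ce0 i j a b X w : (1 <= i)%N -> (1 <= j)%N -> lintT X -> pos P w ->
  rce P (rF i j) (ce0 a b X) w = ce0 (minn a i) (minn b j) X w.
Proof.
move=> i1 j1 lX pw; rewrite /ce0.
have -> : ((minn a i == 0) || (minn b j == 0))%N = ((a == 0) || (b == 0))%N.
  by rewrite -!leqn0 !geq_min !leqn0 [i == 0%N]gtn_eqF// [j == 0%N]gtn_eqF// !orbF.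
case: ifP => _; first by rewrite rce_cst//; exact: rF_partition.
by rewrite rce_F4.
Qed.

Lemma mean_rce_norm r X : measurable_partition r -> lintT X ->
  (mean P (fun w => `|rce P r X w|)%R <= mean P (fun w => `|X w|)%R)%E.
Proof.
move=> pr lX; have lX' : lint P r X.
  by apply: lintS lX => //; exact: setT_partition.
have lN := lint_norm cT pr lX'.
have nX : nonneg (fun w => `|X w|) by split; [case: lN|move=> w; exact: normr_ge0].
have ar Y := adapted_point_atom pr (rce_adapted P Y (proj1 pr)).
apply: (@le_trans _ _ (mean P (rce P r (fun w => `|X w|)))).
  apply: le_mean => //.
  - split; last by move=> w; exact: normr_ge0.
    exact: (adapted_comp (fun x => `|x|)).
  - by split => // w; apply: rce_ge0 => v; exact: normr_ge0.
  - by move=> w _; exact: norm_rce.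
have := mean_rceM cT pr nX (nonneg_cst T (ler01 : 0 <= 1 :> R)) lN (fun _ _ _ => erefl).
under eq_fun do rewrite mulr1.
by move=> ->; under eq_fun do rewrite mulr1.
Qed.

Lemma mean_ce0 i j X : lintT X ->
  (mean P (fun w => `|ce0 i j X w|)%R <= mean P (fun w => `|X w|)%R)%E.
Proof.
move=> lX; rewrite /ce0; case: ifP => _; last first.
  by apply: mean_rce_norm => //; exact: rF_partition.
rewrite normr0 mean_cst; apply: mean_ge0; split; last by move=> w; exact: normr_ge0.
by case: lX => aX _; exact: (adapted_comp (fun x => `|x|)).
Qed.

Lemma compensator_lint i j X : lintT X -> lintT (compensator i j X).
Proof.
have pT := @setT_partition _ T.
by move=> lX; apply: lintB => //; [apply: lintD => //|]; exact: ce0_lint.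
Qed.

Lemma compensator_adapted i j X : adapted (rm i j) (compensator i j X).
Proof.
move=> w v [wv1 wv2]; have wv3 : rF i.-1 j.-1 w v.
  by apply: rF_sub wv1 => //; exact: leq_pred.
by rewrite /compensator (ce0_adapted _ wv1) (ce0_adapted _ wv2) (ce0_adapted _ wv3).
Qed.

Lemma mean_compensator i j X : lintT X ->
  (mean P (fun w => `|compensator i j X w|)%R <=
   3%:E * mean P (fun w => `|X w|)%R)%E.
Proof.
move=> lX.
have nn (Y : T -> R) : lintT Y -> nonneg (fun w => `|Y w|).
  move=> [aY _]; split; last by move=> w; exact: normr_ge0.
  exact: (adapted_comp (fun x => `|x|)).
have n1 := nn _ (ce0_lint i.-1 j lX); have n2 := nn _ (ce0_lint i j.-1 lX).
have n3 := nn _ (ce0_lint i.-1 j.-1 lX).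
apply: (@le_trans _ _ (mean P (fun w =>
    `|ce0 i.-1 j X w| + `|ce0 i j.-1 X w| + `|ce0 i.-1 j.-1 X w|)%R)).
  apply: le_mean => //; [exact/nn/compensator_lint| |].
    by apply: nonnegD => //; exact: nonnegD.
  move=> w _; apply: le_trans (ler_normB _ _) _.
  by rewrite lerD2r ler_normD.
rewrite (meanD P cT (nonnegD n1 n2) n3) (meanD P cT n1 n2).
apply: le_trans (leeD (leeD (mean_ce0 _ _ lX) (mean_ce0 _ _ lX)) (mean_ce0 _ _ lX)) _.
have := mean_ge0 P (nn _ lX); move: (mean _ _) => [a| |] //= a0.
  by rewrite -!EFinD -EFinM lee_fin; lra.
by rewrite mulry gtr0_sg ?mul1e// leey.
Qed.

(** [X] itself is [ce0 k l X] at positive points, so all four terms average by [rce_ce0], which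
    truncates their indices at [(i, j)]. If [i < k], truncation identifies [k] with [k.-1] and the
    terms cancel in pairs; likewise for [j < l]. *)
Lemma rce_difference k l i j X w : (1 <= k)%N -> (1 <= l)%N -> (1 <= i)%N ->
  (1 <= j)%N -> adapted (rF k l) X -> lintT X -> pos P w ->
  rce P (rF i j) (fun v => X v - compensator k l X v) w =
  if (k <= i)%N && (l <= j)%N then X w - compensator k l X w else 0.
Proof.
move=> k1 l1 i1 j1 aX lX pw; have pF := rF_partition cT hF.
have adD : adapted (rF k l) (fun v => X v - compensator k l X v).
  apply: (adapted_comp2 (fun x y => x - y)) => //.
  apply: adaptedS (@compensator_adapted k l X) => v; exact: rF_rm.
case: ifPn => [/andP[ki lj]|nkl].
  by rewrite rce_id//; apply: adaptedS adD => v; exact: rF_sub.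
have lc a b : lint P (rF i j) (ce0 a b X) by exact/(lintT_rF cT hF)/ce0_lint.
have lX' := lintT_rF cT hF i j lX.
have aXp : adapted point_atom X by case: lX.
have lc' : lint P (rF i j) (compensator k l X) by exact/(lintT_rF cT hF)/compensator_lint.
have eX : rce P (rF i j) X w = ce0 (minn k i) (minn l j) X w.
  rewrite -rce_ce0//; apply: eq_rce => //.
    by case: (ce0_lint k l lX).
  move=> v pv _; rewrite /ce0 gtn_eqF// gtn_eqF//=; symmetry; exact: rce_id.
rewrite (rceB (pF i j) w lX' lc') eX /compensator.
rewrite (rceB (pF i j) w (lintD (pF i j) (lc _ _) (lc _ _)) (lc _ _)).
rewrite (rceD (pF i j) w (lc _ _) (lc _ _)) !rce_ce0//.
move: nkl; rewrite negb_and -!ltnNge => /orP[h|h].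
  have -> : minn k.-1 i = minn k i by lia.
  ring.
have -> : minn l.-1 j = minn l j by lia.
ring.
Qed.

(** Averaging over F_{i,j} deletes the summands outside the smaller rectangle. The identity over a
    set of F_{i,j} then follows from its atoms, each tested at one positive point. *)
Lemma martingale_of_differences (X : nat -> nat -> T -> R) :
  (forall k l, (1 <= k)%N -> (1 <= l)%N -> adapted (rF k l) (X k l)) ->
  (forall k l, lintT (X k l)) ->
  martingale P F (fun i j w => \sum_(1 <= k < i.+1) \sum_(1 <= l < j.+1)
    (X k l w - compensator k l (X k l) w)).
Proof.
move=> aX lX; pose D k l w := X k l w - compensator k l (X k l) w.
have pT := @setT_partition _ T; have pF := rF_partition cT hF.
have lD k l : lintT (D k l) by apply: lintB => //; exact: compensator_lint.
have lS i j : lintT (fun w => \sum_(1 <= k < i.+1) \sum_(1 <= l < j.+1) D k l w).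
  by apply: lint_sum => // k; exact: lint_sum.
have aS i j : adapted (rF i j)
    (fun w => \sum_(1 <= k < i.+1) \sum_(1 <= l < j.+1) D k l w).
  move=> w v wv; apply: eq_big_nat => k /andP[k1 ki].
  apply: eq_big_nat => l /andP[l1 lj].
  have wv' : rF k l w v by apply: rF_sub wv.
  by rewrite /D (aX _ _ k1 l1 _ _ wv') (compensator_adapted _ (rF_rm hF wv')).
have rsum (I : Type) (s : seq I) (Y : I -> T -> R) i j w :
    (forall a, lint P (rF i j) (Y a)) -> pos P w ->
    rce P (rF i j) (fun v => \sum_(a <- s) Y a v) w = \sum_(a <- s) rce P (rF i j) (Y a) w.
  move=> lY pw; elim: s => [|a s ih].
    by under eq_fun do rewrite big_nil; rewrite big_nil rce_cst.
  under eq_fun do rewrite big_cons; rewrite big_cons rceD ?ih//.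
  by apply: lint_sum.
have lDF i j k l : lint P (rF i j) (D k l) by exact/(lintT_rF cT hF).
have key i j i' j' w : (1 <= i)%N -> (1 <= j)%N -> (i <= i')%N -> (j <= j')%N ->
    pos P w ->
    rce P (rF i j) (fun v => \sum_(1 <= k < i'.+1) \sum_(1 <= l < j'.+1) D k l v) w =
    \sum_(1 <= k < i.+1) \sum_(1 <= l < j.+1) D k l w.
  move=> i1 j1 ii jj pw; rewrite rsum//; last by move=> k; exact: lint_sum.
  (* The smaller rectangle is padded with zeros to match the case distinction in
     [rce_difference]. *)
  rewrite [RHS](big_nat_widen _ _ i'.+1)//= [RHS]big_mkcond /=.
  apply: eq_big_nat => k /andP[k1 ki']; rewrite rsum//.
  rewrite (big_nat_widen _ _ j'.+1)//= [in RHS]big_mkcond /=.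
  have E l : (1 <= l < j'.+1)%N -> rce P (rF i j) (D k l) w =
      if (k <= i)%N && (l <= j)%N then D k l w else 0.
    by move=> /andP[l1 _]; rewrite rce_difference//; exact: aX.
  rewrite (eq_big_nat _ _ E); rewrite ltnS; case: (k <= i)%N => /=; last by rewrite big1.
  by rewrite [RHS]big_mkcond.
split=> [i j i1 j1|i j i' j' i1 j1 ii jj]; first by have [_ /(_ point)] := lS i j.
have [aS' iS'] := lS i' j'; have [aS0 iS0] := lS i j.
split.
  apply: measurable_fun_atom => //; rewrite -rF_atom//.
  exact: (adapted_comp EFin).
move=> A FA; have mA := bf_sub_measurable hF i1 j1 FA.
apply: (eq_integral_classes cT (pF i j)).
- by rewrite rF_atom//; exact: saturated_atom.
- exact: integrableS (iS0 point).
- exact: integrableS (iS' point).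
move=> w _.
rewrite [LHS](integral_class (pF i j) w (lintT_rF cT hF i j (lS i j))).
rewrite [RHS](integral_class (pF i j) w (lintT_rF cT hF i j (lS i' j'))).
have [pw|/negPn/eqP pw] := boolP (P (rF i j w) != 0%E); last by rewrite pw/= !mulr0.
have [v wv pv] := class_pos cT (pF i j) pw.
have ar Y := rce_adapted P Y (proj1 (pF i j)).
by rewrite -!(ar _ _ _ wv) !key.
Qed.

End martingale_differences.

(** If [|x|] exceeds [sqrt S], then [(sqrt S + |x| / 3)^2 <= S + x^2], so the jump is at most three
    times the increment of the root, and increments telescope. *)
Lemma sum_large_jumps_le (R : realType) (x : nat -> R) K :
  \sum_(k < K)
    (if Num.sqrt (\sum_(l < k) x l ^+ 2) < `|x k| then `|x k| else 0) <=
  3 * Num.sqrt (\sum_(k < K) x k ^+ 2).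
Proof.
elim: K => [|K ih]; first by rewrite !big_ord0 sqrtr0 mulr0.
rewrite !big_ord_recr /=; apply: le_trans (lerD ih (lexx _)) _.
have : 0 <= \sum_(k < K) x k ^+ 2 by apply: sumr_ge0 => k _; exact: sqr_ge0.
move: (\sum_(k < K) x k ^+ 2) => S S0.
have s0 := sqrtr_ge0 S; have sS := sqr_sqrtr S0.
case: ifP => [h|_]; last first.
  by rewrite addr0 ler_pM2l//; apply: ler_wsqrtr; rewrite lerDl sqr_ge0.
suff : Num.sqrt S + `|x K| / 3 <= Num.sqrt (S + x K ^+ 2) by lra.
have x0 := normr_ge0 (x K).
rewrite -[leLHS]ger0_norm; last by rewrite addr_ge0// divr_ge0.
rewrite -sqrtr_sqr; apply: ler_wsqrtr.
rewrite -(real_normK (num_real (x K))) -{2}sS; nra.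
Qed.

(** * Cutting the differences at a predictable threshold *)

Section decomposition.
Context (R : realType) d (T : measurableType d) (P : probability T R).
Hypothesis cT : countable [set: T].
Variable F : nat -> nat -> set (set T).
Hypothesis hF : biparameter_filtration F.
Hypothesis F4 : F4_condition P F.

Local Notation rF := (rF F).
Local Notation rm := (rm F).
Local Notation rG := (rG F).
Local Notation lintT := (lint P (fun=> [set: T])).

Lemma rce_eq0 r (X : T -> R) w : measurable_partition r -> nonneg X ->
  lint P r X -> pos P w -> rce P r X w = 0 -> X w = 0.
Proof.
move=> pr [aX X0] lX pw r0; have [[r1 _] mr] := pr.
have mX : measurable_fun (r w) (EFin \o X).
  by apply/measurable_funTS/measurable_fun_adapted => //; exact: adapted_comp.
have := integral_class pr w lX; rewrite r0 mul0r => i0.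
have : (\int[P]_(v in r w) `|(EFin \o X) v| = 0)%E.
  by rewrite -[RHS]i0; apply: eq_integral => v _; rewrite /= ger0_norm.
move/(ae_eq_integral_abs P (mr w) mX)/(pos_ae cT)/(_ w pw)/(_ (r1 w)).
by case.
Qed.

Variable f : nat -> nat -> T -> R.
Hypothesis mf : martingale P F f.
Hypothesis fin_f : (H1S_norm P f < +oo)%E.

Let x := mdiff f.

Let ax i j : adapted (rF i j) (x i j).
Proof. exact: mdiff_adapted mf. Qed.

Let lx i j : lintT (x i j).
Proof. exact: mdiff_lint mf. Qed.

(** A real-valued S(f): [fine] changes it only where S(f) is infinite, which by [fin_f] happens at
    no positive point. *)
Let s w : R := fine (square_function f w).

Let asq : adapted point_atom (square_function f).
Proof.
move=> w v wv; rewrite /square_function; congr sqrte.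
apply: eq_eseriesr => i _; apply: eq_eseriesr => j _.
by have [a _] := lx i j; rewrite -/x (a _ _ wv).
Qed.

Let ns : nonneg s.
Proof.
split=> [|w]; last by rewrite fine_ge0// sqrte_ge0.
exact: (adapted_comp (@fine R)).
Qed.

Let sE w : pos P w -> square_function f w = (s w)%:E.
Proof.
have isf : P.-integrable setT (square_function f).
  apply/integrableP; split; first exact: measurable_fun_adapted.
  by under eq_integral do rewrite gee0_abs ?sqrte_ge0//.
move=> pw; rewrite /s fineK//.
exact: (pos_ae cT (integrable_ae measurableT isf) pw).
Qed.

Let mean_s : (mean P s <= H1S_norm P f)%E.
Proof.
apply: le_integral_pos => //.
- by apply: adapted_comp; case: ns.
- by move=> w; rewrite lee_fin; case: ns.
- by move=> w; exact: sqrte_ge0.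
- by move=> w pw; rewrite sE.
Qed.

Let xk N k := x (lexi N k) (lexj N k).

Let sum_x_le N K w : (K <= N * N)%N -> pos P w ->
  Num.sqrt (\sum_(k < K) xk N k w ^+ 2) <= s w.
Proof.
move=> KN pw; have s0 : 0 <= s w by case: ns.
rewrite -[leRHS]ger0_norm// -sqrtr_sqr; apply: ler_wsqrtr.
apply: (@le_trans _ _ (\sum_(k < N * N) xk N k w ^+ 2)).
  rewrite -!(big_mkord xpredT (fun k => xk N k w ^+ 2)) [leRHS](big_cat_nat (n := K))//=.
  by rewrite lerDl; apply: sumr_ge0 => k _; exact: sqr_ge0.
rewrite (sum_lex N (fun i j => x i j w ^+ 2)) -lee_fin.
pose e i j := (`|mdiff f i j w| ^+ 2)%:E.
apply: (@le_trans _ _ (\sum_(1 <= i <oo) \sum_(1 <= j <oo) e i j)%E).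
  apply: le_trans (grid_le_series N (e := e) _); last by move=> i j; rewrite lee_fin sqr_ge0.
  rewrite -sumEFin; apply: lee_sum => i _; rewrite -sumEFin; apply: lee_sum => j _.
  by rewrite /e real_normK// num_real.
have e0 : (0 <= \sum_(1 <= i <oo) \sum_(1 <= j <oo) e i j)%E.
  apply: nneseries_ge0 => i _ _; apply: nneseries_ge0 => j _ _.
  by rewrite lee_fin sqr_ge0.
rewrite -[leLHS](sqr_sqrte e0).
have -> : sqrte (\sum_(1 <= i <oo) \sum_(1 <= j <oo) e i j)%E = (s w)%:E by rewrite -sE.
by rewrite expe2 -EFinM expr2.
Qed.

Let Y w := Num.sqrt (s w).

Let nY : nonneg Y.
Proof.
split=> [|w]; last exact: sqrtr_ge0.
by apply: (adapted_comp Num.sqrt); case: ns.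
Qed.

Let Y2 : (fun w => Y w ^+ 2) = s.
Proof. by apply/funext => w; rewrite /Y sqr_sqrtr//; case: ns. Qed.

Let fY : (mean P (fun w => (Y w ^+ 2)%R) < +oo)%E.
Proof. by rewrite Y2; apply: le_lt_trans mean_s fin_f. Qed.

Let lY : lintT Y := lintT_of_sqr cT nY fY.

Let m i j := rce P (rm i j) Y.
(** The square of [2 * m], so that [Y <= 2 * m] amounts to [s <= la]. *)
Let la i j w := 4 * m i j w ^+ 2.

Let pF := rF_partition cT hF.
Let pm := rm_partition cT hF.
Let pG := rG_partition cT hF.

Let am i j : adapted (rm i j) (m i j).
Proof. exact: (rce_adapted P Y (proj1 (pm i j))). Qed.

Let m0 i j w : 0 <= m i j w.
Proof. by apply: rce_ge0; case: nY. Qed.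

Let ala i j : adapted (rm i j) (la i j).
Proof. exact: (adapted_comp (fun y => 4 * y ^+ 2)). Qed.

Let la0 i j w : 0 <= la i j w.
Proof. by rewrite mulr_ge0// sqr_ge0. Qed.

Let alaF i j : adapted (rF i j) (la i j).
Proof. by apply: adaptedS (@ala i j) => w; exact: rF_rm. Qed.

Let V i j w := if `|x i j w| <= la i j w then 0 else x i j w.
Let U i j w := if `|x i j w| <= la i j w then x i j w else 0.

Let aV i j : adapted (rF i j) (V i j).
Proof. by move=> w v wv; rewrite /V (ax wv) (alaF wv). Qed.

Let aU i j : adapted (rF i j) (U i j).
Proof. by move=> w v wv; rewrite /U (ax wv) (alaF wv). Qed.

Let lV i j : lintT (V i j).
Proof.
apply: (lint_le cT (@setT_partition _ T)) (lx i j).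
  exact: adapted_point_atom (pF i j) (@aV i j).
by move=> w _; rewrite /V; case: ifP; rewrite ?normr0.
Qed.

Let nV i j : nonneg (fun w => `|V i j w|).
Proof.
split=> [|w]; last exact: normr_ge0.
by apply: (adapted_comp (fun y => `|y|)); case: (lV i j).
Qed.

Let lm i j X : lintT X -> lint P (rm i j) X.
Proof. by move=> lX; apply: lintS lX => //; exact: setT_partition. Qed.

Let past N k w := Num.sqrt (\sum_(l < k) xk N l w ^+ 2).
Let small N k w : R := if past N k w <= la (lexi N k) (lexj N k) w then 1 else 0.

Let x_rG N k l : (0 < N)%N -> (l < k)%N ->
  adapted (rG N (lexi N k) (lexj N k)) (xk N l).
Proof.
move=> N0 lk; apply: adaptedS (@ax (lexi N l) (lexj N l)) => w.
exact: rG_lex_rF.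
Qed.

Let la_rG N k l : (0 < N)%N -> (l <= k)%N ->
  adapted (rG N (lexi N k) (lexj N k)) (la (lexi N l) (lexj N l)).
Proof.
move=> N0 lk; apply: adaptedS (@ala (lexi N l) (lexj N l)) => w v wv.
apply: (rG_rm hF (lexj_le l N0)); exact: (rG_lex_homo hF N0 lk wv).
Qed.

Let small_rG N k : (0 < N)%N -> adapted (rG N (lexi N k) (lexj N k)) (small N k).
Proof.
move=> N0 w v wv; rewrite /small (la_rG N0 (leqnn k) wv) (_ : past N k v = past N k w)//.
rewrite /past; congr Num.sqrt; apply: eq_bigr => l _.
by rewrite (x_rG N0 (ltn_ord l) wv).
Qed.

Let nsmall N k : (0 < N)%N -> nonneg (small N k).
Proof.
move=> N0; split.
  by apply: adapted_point_atom (pG N (lexi N k) (lexj N k)) _; exact: small_rG.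
by move=> w; rewrite /small; case: ifP.
Qed.

Let lsmall N k : (0 < N)%N -> lintT (small N k).
Proof.
move=> N0; apply: (lint_le cT (@setT_partition _ T)) (lint_cst P (@setT_partition _ T) 1).
  by case: (nsmall k N0).
by move=> w _; rewrite /small normr1; case: ifP; rewrite ?normr1 ?normr0.
Qed.

(* Markov: on a class of [rm], [sqrt s] exceeds twice its mean [m] with
   probability at most 1/2, and [past N k <= s]. *)
Let small_half N k w : (k < N * N)%N -> pos P w ->
  `|V (lexi N k) (lexj N k) w| <=
  2 * (`|V (lexi N k) (lexj N k) w| * rce P (rm (lexi N k) (lexj N k)) (small N k) w).
Proof.
move=> kN pw; have N0 : (0 < N)%N by case: (N) kN.
set i := lexi N k; set j := lexj N k.
have ls : lint P (rm i j) (small N k) by exact/lm/lsmall.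
have c1 : lint P (rm i j) (fun=> 1) by exact: lint_cst.
have l1 : lint P (rm i j) (fun v => 1 - small N k v) by exact: lintB.
have c2 : adapted (rm i j) (fun=> 2 * m i j w) by [].
have h : 2 * m i j w * (1 - rce P (rm i j) (small N k) w) <= m i j w.
  rewrite -[X in _ * (X - _)](rce_cst cT (pm i j) 1 pw) -rceB// -(rceM (pm i j) w c2 l1).
  apply: le_rce => //; [exact: lintZ|exact: lm|].
  move=> v pv wv; rewrite /small -/i -/j (ala wv); case: ifP => [_|].
    by rewrite subrr mulr0; case: nY.
  move=> /negbT; rewrite -ltNge => hs; rewrite subr0 mulr1.
  have h1 : past N k v <= s v by apply: sum_x_le => //; exact: ltnW.
  have h2 : 0 <= 2 * m i j w by rewrite mulr_ge0.
  rewrite -[leLHS]ger0_norm// -sqrtr_sqr; apply: ler_wsqrtr.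
  apply: le_trans h1; apply: le_trans (ltW hs).
  rewrite /la; lra.
have V0 := normr_ge0 (V i j w).
have [mz|mnz] := eqVneq (m i j w) 0; last first.
  have mp : 0 < m i j w by rewrite lt0r mnz m0.
  have : 1 <= 2 * rce P (rm i j) (small N k) w.
    by rewrite -(ler_pM2l mp); lra.
  nra.
have Yw : Y w = 0 by exact: (rce_eq0 (pm i j) nY (lm i j lY) pw mz).
have sw : s w <= 0 by rewrite -sqrtr_eq0 -/(Y w) Yw.
have : xk N k w ^+ 2 <= 0.
  have := sum_x_le kN pw; rewrite big_ord_recr /= => h1.
  have h2 : 0 <= \sum_(l < k) xk N l w ^+ 2 by apply: sumr_ge0 => l _; exact: sqr_ge0.
  have /eqP := le_trans h1 sw.
  have : Num.sqrt (\sum_(l < k) xk N l w ^+ 2 + xk N k w ^+ 2) == 0.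
    by rewrite eq_le sqrtr_ge0 andbT (le_trans h1 sw).
  by rewrite sqrtr_eq0; lra.
rewrite real_exprn_even_le0 ?num_real//= => /eqP xw.
have -> : V i j w = 0 by rewrite /V -/(xk N k w) xw; case: ifP.
by rewrite normr0 mul0r mulr0.
Qed.

(** [small] depends on the lexicographic past only. Conditional independence averages [|V|] over
    F^-_{i,j} next to it, self-adjointness moves the averaging onto [small], and [small_half]
    applies pointwise. *)
Let mean_V N k : (k < N * N)%N ->
  (mean P (fun w => `|V (lexi N k) (lexj N k) w|)%R <=
   2%:E * mean P (fun w => `|V (lexi N k) (lexj N k) w| * small N k w)%R)%E.
Proof.
move=> kN; have N0 : (0 < N)%N by case: (N) kN.
set i := lexi N k; set j := lexj N k.
have ls : lint P (rm i j) (small N k) by exact/lm/lsmall.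
have lN : lint P (rm i j) (fun w => `|V i j w|) by apply: lint_norm => //; exact: lm.
have nr (X : T -> R) : nonneg X -> nonneg (rce P (rm i j) X).
  move=> [_ X0]; split; last by move=> w; exact: rce_ge0.
  exact: adapted_point_atom (pm i j) (rce_adapted P X (proj1 (pm i j))).
have ar X := rce_adapted P X (proj1 (pm i j)).
have nsm := nsmall k N0.
have aN : adapted (rF i j) (fun w => `|V i j w|).
  by move=> w v wv; rewrite (aV wv).
have E1 : mean P (fun w => rce P (rm i j) (fun v => `|V i j v|) w * small N k w) =
          mean P (fun w => `|V i j w| * small N k w).
  apply: (integral_rce_rm cT hF F4 (N := N)) => //.
  - exact: lexj_le.
  - by case: nsm.
  - exact: small_rG.
have E2 := mean_rceM cT (pm i j) nsm (nr _ (nV i j)) ls (ar _).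
have E3 := mean_rceM cT (pm i j) (nV i j) (nr _ nsm) lN (ar _).
have C (X Z : T -> R) : mean P (fun w => X w * Z w) = mean P (fun w => Z w * X w).
  by congr (mean P); apply/funext => w; rewrite mulrC.
have -> : mean P (fun w => `|V i j w| * small N k w) =
          mean P (fun w => `|V i j w| * rce P (rm i j) (small N k) w).
  by rewrite -E3 C E2 C; symmetry; exact: E1.
have nM := nonnegM (nV i j) (nr _ nsm).
rewrite -(meanZ P cT nM)//; apply: le_mean => //.
  by apply: nonnegM => //; exact: nonneg_cst.
by move=> w pw; exact: small_half.
Qed.

(** Where [small] is 1 and [V] is nonzero, [|x| > la >= past], a large jump in the sense of
    [sum_large_jumps_le]; 6 combines its 3 with the 2 of [mean_V]. *)
Let sum_mean_V N :
  (\sum_(1 <= i < N.+1) \sum_(1 <= j < N.+1) mean P (fun w => `|V i j w|)%R <=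
   6%:E * H1S_norm P f)%E.
Proof.
rewrite -(sum_lex N (fun i j => mean P (fun w => `|V i j w|)%R)).
have [->|N0] := posnP N.
  by rewrite muln0 big_ord0 mule_ge0//; apply: integral_ge0 => w _; exact: sqrte_ge0.
have nVs k : nonneg (fun w => `|V (lexi N k) (lexj N k) w| * small N k w).
  by apply: nonnegM => //; exact: nsmall.
have nS : nonneg (fun w => \sum_(k < N * N)
    `|V (lexi N k) (lexj N k) w| * small N k w).
  exact: (nonneg_sum _ (fun k : 'I_(N * N) => nVs k)).
apply: (@le_trans _ _ (2%:E * mean P (fun w => \sum_(k < N * N)
    `|V (lexi N k) (lexj N k) w| * small N k w)%R)%E).
  rewrite (mean_sum P cT _ (fun k : 'I_(N * N) => nVs k)) ge0_sume_distrr; last first.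
    by move=> k _; exact: mean_ge0.
  by apply: lee_sum => k _; exact: mean_V.
rewrite (_ : 6 = 2 * 3 :> R); last by ring.
rewrite EFinM -muleA; apply: lee_wpmul2l; first by rewrite lee_fin.
apply: le_trans (lee_wpmul2l _ mean_s); last by rewrite lee_fin.
rewrite -(meanZ P cT ns)//; apply: le_mean => //.
  by apply: nonnegM => //; exact: nonneg_cst.
move=> w pw; have := sum_x_le (leqnn (N * N)) pw => hx.
apply: (@le_trans _ _ (3 * Num.sqrt (\sum_(k < N * N) xk N k w ^+ 2))); last first.
  by rewrite ler_pM2l.
apply: le_trans (sum_large_jumps_le (fun k => xk N k w) (N * N)).
apply: ler_sum => k _; rewrite /small /V -/(xk N k w) -/(past N k w).
case: ifP => [_|/negbT]; first by rewrite normr0 mul0r; case: ifP.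
rewrite -ltNge => h; case: ifP => h'; last by rewrite mulr0; case: ifP.
by rewrite (le_lt_trans h' h) mulr1.
Qed.

Let H0 : (0 <= H1S_norm P f)%E.
Proof. by apply: integral_ge0 => w _; exact: sqrte_ge0. Qed.

Let HE : H1S_norm P f = (fine (H1S_norm P f))%:E.
Proof. by rewrite fineK// ge0_fin_numE. Qed.

Let a2 i j : nonneg (fun w => U i j w ^+ 2).
Proof. by apply: nonneg_sqr; exact: adapted_point_atom (pF i j) (@aU i j). Qed.

Let U_la i j w : `|U i j w| <= la i j w.
Proof. by rewrite /U; case: ifP; rewrite ?normr0. Qed.

Let lU2 i j : lint P (rm i j) (fun w => U i j w ^+ 2).
Proof.
have l2 : adapted (rm i j) (fun w => la i j w ^+ 2).
  exact: (adapted_comp (fun y => y ^+ 2)).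
apply: (lint_le cT (pm i j)) (lint_adapted P (pm i j) l2); first by case: (a2 i j).
move=> w _; rewrite !normrX (ger0_norm (la0 i j w)).
by rewrite ler_pXn2r ?nnegrE.
Qed.

Let nrU i j : nonneg (rce P (rm i j) (fun w => U i j w ^+ 2)).
Proof.
split; first exact: adapted_point_atom (pm i j) (rce_adapted P _ (proj1 (pm i j))).
by move=> w; apply: rce_ge0 => v; exact: sqr_ge0.
Qed.

Let nla i j : nonneg (la i j).
Proof. by split=> //; exact: adapted_point_atom (pm i j) (@ala i j). Qed.

Let lamax N K w := runmax (fun k => la (lexi N k) (lexj N k) w) K.

Let nlamax N K : nonneg (lamax N K).
Proof. by apply: nonneg_runmax => k _; case: (nla (lexi N k) (lexj N k)). Qed.

Let mean_lamax N : (mean P (lamax N (N * N)) <= 256%:E * H1S_norm P f)%E.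
Proof.
pose mm w := runmax (fun k => m (lexi N k) (lexj N k) w) (N * N).
have nmm : nonneg mm.
  by apply: nonneg_runmax => k _; exact: adapted_point_atom (pm _ _) (@am _ _).
have nmm2 : nonneg (fun w => mm w ^+ 2) by apply: nonneg_sqr; case: nmm.
apply: (@le_trans _ _ (4%:E * mean P (fun w => mm w ^+ 2)%R)%E).
  rewrite -(meanZ P cT nmm2)//; apply: le_mean => //.
    by apply: nonnegM => //; exact: nonneg_cst.
  move=> w _; apply: runmax_le; first by rewrite mulr_ge0// sqr_ge0.
  move=> k kN; rewrite /la ler_pM2l// ler_pXn2r ?nnegrE//; last by case: nmm.
  exact: (le_runmax (fun k => m (lexi N k) (lexj N k) w)).
rewrite (_ : 256 = 4 * 64 :> R); last by ring.
rewrite EFinM -muleA; apply: lee_wpmul2l; first by rewrite lee_fin.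
apply: le_trans (maximal_rm cT hF F4 N nY fY) _; rewrite Y2.
by apply: lee_wpmul2l; first by rewrite lee_fin.
Qed.

Let sum_U_le N w : pos P w -> Num.sqrt (\sum_(k < N * N)
  U (lexi N k) (lexj N k) w ^+ 2) <= s w.
Proof.
move=> pw; apply: le_trans (sum_x_le (leqnn (N * N)) pw).
apply: ler_wsqrtr; apply: ler_sum => k _; rewrite /U -/(xk N k w).
by case: ifP => // _; rewrite expr0n sqr_ge0.
Qed.

(** Compared with the bound of S(g), squares and conditional squares exchange roles. The weight at
    step [k] is the sum of the earlier [U^2] plus the squared running maximum of [la] including step
    [k]: it depends on the past only, and dominates the sum up to step [k] because [|U| <= la]. Its
    root is at most [s] plus the maximum, whence 257 = 1 + 256. *)
Let mean_sqrt_U N :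
  (mean P (fun w => Num.sqrt (\sum_(1 <= i < N.+1) \sum_(1 <= j < N.+1)
     rce P (rm i j) (fun v => U i j v ^+ 2) w))%R <=
   (3 / 2 * 257)%:E * H1S_norm P f)%E.
Proof.
rewrite sqrt_grid_lex; set K := (N * N)%N.
have [N0|N0] := posnP N.
  rewrite /K N0 muln0; under eq_fun do rewrite big_ord0 sqrtr0.
  rewrite mean_cst; apply: mule_ge0; last exact: H0.
  rewrite lee_fin; lra.
pose a k := fun w => U (lexi N k) (lexj N k) w ^+ 2.
pose b k := rce P (rm (lexi N k) (lexj N k)) (a k).
have na k : nonneg (a k) by exact: a2.
have nb k : nonneg (b k) by exact: nrU.
have nS k : nonneg (fun w => \sum_(l < k) a l w).
  exact: (nonneg_sum _ (fun l : 'I_k => na l)).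
have nL k : nonneg (fun w => lamax N k w ^+ 2).
  by apply: nonneg_sqr; case: (nlamax N k).
have nD k l : nonneg (fun w => \sum_(i < k) a i w + lamax N l w ^+ 2).
  exact: nonnegD.
have lm0 k w : 0 <= lamax N k w by exact: runmax_ge0.
have S0 k w : 0 <= \sum_(l < k) a l w by apply: sumr_ge0 => l _; exact: sqr_ge0.
apply: (@le_trans _ _ ((3 / 2)%:E * mean P (fun w =>
    Num.sqrt (\sum_(l < K) a l w + lamax N K w ^+ 2))%R)%E).
  apply: (mean_sqrt_sum_le_limit cT (a := a) (b := b)
    (D := fun k w => \sum_(l < k) a l w + lamax N k.+1 w ^+ 2)) => //.
  - move=> k w kK; apply: lerD.
      rewrite -!(big_mkord xpredT (a^~ w)) [leRHS](big_cat_nat (n := k))//=; last exact: ltnW.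
      by rewrite lerDl; apply: sumr_ge0 => l _; exact: sqr_ge0.
    by rewrite ler_pXn2r ?nnegrE//; exact: runmax_homo.
  - move=> k w kK; rewrite big_ord_recr /= lerD2l /a -[leLHS]real_normK ?num_real//.
    rewrite ler_pXn2r ?nnegrE// (le_trans (U_la _ _ _))//.
    exact: (le_runmax (fun k => la (lexi N k) (lexj N k) w)).
  - move=> k e kK e0; rewrite le_eqVlt; apply/orP; left; apply/eqP.
    apply: (integral_rce_rm cT hF F4 (N := N)) => //.
    + exact: lexj_le.
    + by case: (na k).
    + exact: (adapted_comp (fun y => y ^+ 2)).
    + apply: (adapted_comp (fun y => (Num.sqrt (e + y))^-1)).
      apply: adapted_comp2.
        apply: adapted_sum => l _; apply: (adapted_comp (fun y => y ^+ 2)).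
        by apply: adaptedS (@aU _ _) => w; apply: rG_lex_rF => //; exact: ltn_ord.
      apply: (adapted_comp (fun y => y ^+ 2)); apply: adapted_runmax => l lk.
      by apply: la_rG => //.
rewrite [in leRHS]EFinM -[leRHS]muleA; apply: lee_wpmul2l; first by rewrite lee_fin.
apply: (@le_trans _ _ (mean P (fun w => s w + lamax N K w)%R)).
  apply: le_mean => //.
  - split=> [|w]; last exact: sqrtr_ge0.
    by apply: (adapted_comp Num.sqrt); case: (nD K K).
  - exact: nonnegD.
  move=> w pw; have h := sum_U_le N pw; have l0 := lm0 K w.
  have h0 := sqrtr_ge0 (\sum_(l < K) a l w); have h2 := sqr_sqrtr (S0 K w).
  apply: (@le_trans _ _ (Num.sqrt (\sum_(l < K) a l w) + lamax N K w)); last first.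
    by rewrite lerD2r.
  rewrite -[leRHS]ger0_norm ?addr_ge0// -sqrtr_sqr; apply: ler_wsqrtr.
  rewrite -{1}h2; nra.
rewrite meanD//; apply: le_trans (leeD mean_s (mean_lamax N)) _.
rewrite HE -!EFinM -EFinD lee_fin; have := fine_ge0 H0; lra.
Qed.

Let C i j := compensator P F i j (V i j).

Let lC i j : lintT (C i j).
Proof. exact: compensator_lint. Qed.

Let aC i j : adapted (rm i j) (C i j).
Proof. exact: compensator_adapted. Qed.

Let nC i j : nonneg (fun w => `|C i j w|).
Proof.
split=> [|w]; last exact: normr_ge0.
by apply: (adapted_comp (fun y => `|y|)); case: (lC i j).
Qed.

Let h i j w :=
  \sum_(1 <= k < i.+1) \sum_(1 <= l < j.+1) (V k l w - C k l w).

Let g i j w := f i j w - h i j w.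

Let mh : martingale P F h.
Proof. exact: martingale_of_differences. Qed.

Let mg : martingale P F g.
Proof. exact: martingaleB. Qed.

Let mdiff_h i j w : (1 <= i)%N -> (1 <= j)%N -> mdiff h i j w = V i j w - C i j w.
Proof. by move=> i1 j1; rewrite /h (mdiff_sum (fun k l w => V k l w - C k l w)). Qed.

Let mdiff_g i j w : (1 <= i)%N -> (1 <= j)%N -> mdiff g i j w = U i j w + C i j w.
Proof.
move=> i1 j1; rewrite /g mdiffB mdiff_h// -/(x i j w) /U /V.
by case: ifP => _; ring.
Qed.

Let sum_mdiff_h : (sum_mdiff_norm P h <= 24%:E * H1S_norm P f)%E.
Proof.
apply: series_le_grid => [i j|N]; first by apply: expectation_ge0.
rewrite (_ : 24 = 4 * 6 :> R); last by ring.
rewrite EFinM -muleA.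
apply: (@le_trans _ _ (4%:E * (\sum_(1 <= i < N.+1) \sum_(1 <= j < N.+1)
    mean P (fun w => `|V i j w|)%R))%E); last first.
  by apply: lee_wpmul2l => //; rewrite lee_fin.
rewrite ge0_sume_distrr; last by move=> i _; apply: sume_ge0 => j _; exact: mean_ge0.
rewrite big_nat [leRHS]big_nat; apply: lee_sum => i /andP[i1 _].
rewrite ge0_sume_distrr; last by move=> j _; exact: mean_ge0.
rewrite big_nat [leRHS]big_nat; apply: lee_sum => j /andP[j1 _].
rewrite unlock -[leLHS]/(mean P (fun w => `|mdiff h i j w|)).
apply: (@le_trans _ _ (mean P (fun w => `|V i j w| + `|C i j w|)%R)).
  apply: le_mean => //.
  - split=> [|w]; last exact: normr_ge0.
    by apply: (adapted_comp (fun y => `|y|)); case: (mdiff_lint cT hF i j mh).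
  - exact: nonnegD.
  - by move=> w _; rewrite mdiff_h// ler_normB.
rewrite meanD//; apply: le_trans (leeD (lexx _) (mean_compensator cT hF i j (lV i j))) _.
have := mean_ge0 P (nV i j); move: (mean _ _) => [r| |] //= r0.
  by rewrite -!EFinM -EFinD lee_fin; lra.
by rewrite [leRHS]mulry gtr0_sg ?mul1e// leey.
Qed.

Let sum_C N : (\sum_(1 <= i < N.+1) \sum_(1 <= j < N.+1)
    mean P (fun w => `|C i j w|)%R <= 18%:E * H1S_norm P f)%E.
Proof.
rewrite (_ : 18 = 3 * 6 :> R); last by ring.
rewrite EFinM -muleA.
apply: (@le_trans _ _ (3%:E * (\sum_(1 <= i < N.+1) \sum_(1 <= j < N.+1)
    mean P (fun w => `|V i j w|)%R))%E); last first.
  by apply: lee_wpmul2l => //; rewrite lee_fin.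
rewrite ge0_sume_distrr; last by move=> i _; apply: sume_ge0 => j _; exact: mean_ge0.
apply: lee_sum => i _; rewrite ge0_sume_distrr; last by move=> j _; exact: mean_ge0.
by apply: lee_sum => j _; exact: mean_compensator.
Qed.

(** The differences of [g] are [U + C]. Since [C] is constant on the classes of [rm], conditioning
    leaves [C^2] unchanged, and its contribution is bounded by the sum of the [|C|]. *)
Let H1sigma_g : (H1sigma_norm P F g <= 807%:E * H1S_norm P f)%E.
Proof.
pose z i j w := `|mdiff g i j w| ^+ 2.
have nz i j : nonneg (z i j).
  split=> [|w]; last exact: sqr_ge0.
  apply: (adapted_comp (fun y => `|y| ^+ 2)).
  by case: (mdiff_lint cT hF i j mg).
have nC2 i j : nonneg (fun w => C i j w ^+ 2) by apply: nonneg_sqr; case: (lC i j).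
have aC2 i j : adapted (rm i j) (fun w => C i j w ^+ 2).
  exact: (adapted_comp (fun y => y ^+ 2)).
(* [C^2] need not be integrable, but it is constant on each class of [rm] and thus integrable
   there. *)
have lC2 i j : lint P (rm i j) (fun w => C i j w ^+ 2) by exact: lint_adapted.
have lB i j : lint P (rm i j) (fun w => 2 * U i j w ^+ 2 + 2 * C i j w ^+ 2).
  by apply: lintD => //; exact: (lintZ (pm i j) (Y := fun=> 2)).
have zB i j w : z i j w <= 2 * U i j w ^+ 2 + 2 * C i j w ^+ 2.
  rewrite /z real_normK ?num_real//.
  have [hij|] := boolP ((i == 0)%N || (j == 0)%N).
    rewrite (_ : mdiff g i j w = 0); last by case: (i) (j) hij => [|[|?]] [|[|?]].
    by rewrite expr0n addr_ge0// mulr_ge0// sqr_ge0.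
  rewrite negb_or -!lt0n => /andP[i1 j1]; rewrite mdiff_g//.
  by have := sqr_ge0 (U i j w - C i j w); nra.
have lz i j : lint P (rm i j) (z i j).
  apply: (lint_le cT (pm i j) _ _ (lB i j)); first by case: (nz i j).
  move=> w _; rewrite !ger0_norm//; last by case: (nz i j).
  by rewrite addr_ge0// mulr_ge0// sqr_ge0.
have nr i j : nonneg (rce P (rm i j) (z i j)).
  split; first exact: adapted_point_atom (pm i j) (rce_adapted P _ (proj1 (pm i j))).
  by move=> w; apply: rce_ge0; case: (nz i j).
have rB i j w : pos P w -> rce P (rm i j) (z i j) w <=
    2 * rce P (rm i j) (fun v => U i j v ^+ 2) w + 2 * `|C i j w| ^+ 2.
  move=> pw; rewrite real_normK ?num_real//.
  have <- : rce P (rm i j) (fun v => C i j v ^+ 2) w = C i j w ^+ 2 by exact: rce_id.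
  rewrite -(rceM (pm i j) w (Y := fun=> 2) _ (lU2 i j))//.
  rewrite -(rceM (pm i j) w (Y := fun=> 2) _ (lC2 i j))//.
  rewrite -rceD//; [|exact: (lintZ (pm i j) (Y := fun=> 2))|exact: (lintZ (pm i j) (Y := fun=> 2))].
  by apply: le_rce.
have -> : H1sigma_norm P F g = (\int[P]_w sqrte (\sum_(1 <= i <oo)
    \sum_(1 <= j <oo) (rce P (rm i j) (z i j) w)%:E))%E.
  apply: eq_integral_pos => //.
  - exact: (cond_square_function_adapted cT hF mg).
  - move=> w v wv; congr sqrte; apply: eq_eseriesr => i _; apply: eq_eseriesr => j _.
    by have [a _] := nr i j; rewrite (a _ _ wv).
  move=> w pw; congr sqrte; apply: eq_eseriesr => i _; apply: eq_eseriesr => j _.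
  rewrite -[X in cond_exp _ _ X]/(EFin \o z i j) (cond_exp_Fminus cT hF)//.
  - by rewrite cev_rce.
  - by apply: adapted_comp; case: (nz i j).
  - by move=> v; rewrite lee_fin; case: (nz i j).
have ngrid (u : nat -> nat -> T -> R) N : (forall i j, nonneg (u i j)) ->
    nonneg (fun w => \sum_(1 <= i < N.+1) \sum_(1 <= j < N.+1) u i j w).
  by move=> nu; apply: nonneg_sum => i; apply: nonneg_sum => j.
have nsqrt (X : T -> R) : nonneg X -> nonneg (fun w => Num.sqrt (X w)).
  move=> [aX _]; split=> [|w]; last exact: sqrtr_ge0.
  exact: (adapted_comp (fun y => Num.sqrt y)).
apply: integral_sqrte_series_le => // N.
have n1 := nsqrt _ (ngrid _ N nrU); have n2 := ngrid _ N nC.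
apply: (@le_trans _ _ (mean P (fun w => 2 * (Num.sqrt
   (\sum_(1 <= i < N.+1) \sum_(1 <= j < N.+1)
      rce P (rm i j) (fun v => U i j v ^+ 2) w) +
    \sum_(1 <= i < N.+1) \sum_(1 <= j < N.+1) `|C i j w|))%R)).
  apply: le_mean => //.
  - by apply: nsqrt; apply: ngrid.
  - by apply: nonnegM; [exact: nonneg_cst|exact: nonnegD].
  move=> w pw; apply: sqrt_grid_add_le => // i j.
  - by case: (nrU i j).
  - by case: (nr i j).
  - exact: rB.
rewrite (meanZ P cT (nonnegD n1 n2))// (meanD P cT n1 n2).
have h2 : (mean P (fun w => \sum_(1 <= i < N.+1) \sum_(1 <= j < N.+1)
    `|C i j w|)%R <= 18%:E * H1S_norm P f)%E.
  rewrite mean_sum//; last by move=> i; exact: nonneg_sum.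
  by under eq_bigr do rewrite mean_sum//.
apply: le_trans (lee_wpmul2l _ (leeD (mean_sqrt_U N) h2)) _; first by rewrite lee_fin.
have := fine_ge0 H0; rewrite HE /=; move: (fine _) => r r0.
have -> : (2%:E * ((3 / 2 * 257)%:E * r%:E + 18%:E * r%:E) =
           (2 * (3 / 2 * 257 * r + 18 * r))%:E)%E by [].
rewrite -EFinM lee_fin; lra.
Qed.

Lemma inf_decomposition_le_fin :
  (inf_decomposition P F f <= 831%:E * H1S_norm P f)%E.
Proof.
apply: (@le_trans _ _ (H1sigma_norm P F g + sum_mdiff_norm P h)%E).
  apply: ereal_inf_lbound; exists g, h; split => // i j w _ _.
  by rewrite /g subrK.
apply: le_trans (leeD H1sigma_g sum_mdiff_h) _.
rewrite HE -!EFinM -EFinD lee_fin; have := fine_ge0 H0; lra.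
Qed.

End decomposition.

Lemma inf_decomposition_le (R : realType) d (T : measurableType d)
    (P : probability T R) (F : nat -> nat -> set (set T)) f :
  countable [set: T] -> biparameter_filtration F -> F4_condition P F ->
  martingale P F f -> (inf_decomposition P F f <= 831%:E * H1S_norm P f)%E.
Proof.
move=> cT hF F4 mf; have [->|] := eqVneq (H1S_norm P f) +oo%E.
  rewrite gt0_muley; first exact: leey.
  by rewrite lte_fin ltr0n.
by rewrite -ltey => ff; exact: inf_decomposition_le_fin.
Qed.

Theorem theorem4p3 (R : realType) (d : measure_display) (T : measurableType d)
    (P : probability T R) (T_countable : countable [set: T])
    (F : nat -> nat -> set (set T))
    (F_filtration : biparameter_filtration F) (F_F4 : F4_condition P F) :
  exists c C : R, [/\ 0 < c, 0 < C &
    forall f : nat -> nat -> T -> R, martingale P F f ->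
      (H1S_norm P f <= C%:E * inf_decomposition P F f)%E /\
      (inf_decomposition P F f <= c%:E * H1S_norm P f)%E].
Proof.
exists 831, 3; split; [by rewrite ltr0n|by rewrite ltr0n|move=> f mf].
split; last exact: inf_decomposition_le.
(* With the constant moved to the left, the claim is that [H1S_norm P f] over 3 is a lower bound for
   all decompositions. *)
rewrite -lee_pdivrMl//; apply: le_ereal_inf_tmp => _ [g [h [mg mh fgh ->]]].
by rewrite lee_pdivrMl//; exact: H1S_norm_le.
Qed.
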